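(* Rim-finite compacta are not classifiable by countable structures; that is, the homeomorphism equivalence relation on the set of all rim-finite compacta in $2^Q$ is not classifiable by countable structures.
   Context: $Q=[0,1]^{\mathbb N}$ is the Hilbert cube; $2^Q$ is the hyperspace of all (nonempty) compact subsets of $Q$ with the Hausdorff metric; a class $\mathcal C$ of metrizable compacta is coded by $\mathcal C\cap 2^Q$ with the induced Borel structure. A compact space is rim-finite if it has an open base formed by sets with finite boundaries. An equivalence relation $E$ on $X$ is Borel reducible to $F$ on $Y$ if there is a Borel map $f\colon X\to Y$ with $x\,E\,x' \iff f(x)\,F\,f(x')$ for all $x,x'\in X$. $E$ is classifiable by countable structures if there is a countable relational language $\mathcal L$ such that $E$ is Borel reducible to the isomorphism relation of $\mathcal L$-structures with underlying set $\mathbb N$. *)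

(* Defs.v *)
From HB Require Import structures.
From mathcomp Require Import all_boot all_order all_algebra.
From mathcomp Require Import finmap lra.
From mathcomp Require Import all_classical all_reals all_analysis.
Set Implicit Arguments.
Unset Strict Implicit.
Unset Printing Implicit Defensive.
Import Order.TTheory GRing.Theory Num.Theory.
Import numFieldTopology.Exports.
Local Open Scope classical_set_scope.
Local Open Scope ring_scope.

(* [0,1]^nat with the topology induced by the product topology; the sup metric
   below is proved compatible with this uniform structure (ball_entourageE). *)
Definition hilbert_cube (R : realType) : Type :=
  set_type [set x : prod_topology (fun _ : nat => R) | forall n, 0 <= x n <= 1].

HB.instance Definition _ (R : realType) := Uniform.on (hilbert_cube R).

Section hilbert_cube_metric.
Variable R : realType.
Implicit Types x y z : hilbert_cube R.

Definition hilbert_dist x y : R :=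
  sup (range (fun n : nat => `|set_val x n - set_val y n| / 2 ^+ n)).

Let coord01 x n : 0 <= set_val x n <= 1.
Proof. exact: (set_valP x n). Qed.

Let term_le1 x y n : `|set_val x n - set_val y n| / 2 ^+ n <= 1.
Proof.
have p2 : 0 < 2 ^+ n :> R by rewrite exprn_gt0.
rewrite ler_pdivrMr // mul1r (@le_trans _ _ 1) //; last first.
  by rewrite exprn_ege1 // ler1n.
move: (coord01 x n) (coord01 y n) => /andP[? ?] /andP[? ?].
by rewrite ler_norml; apply/andP; split; lra.
Qed.

Let has_sup_term x y :
  has_sup (range (fun n : nat => `|set_val x n - set_val y n| / 2 ^+ n)).
Proof.
split; first by exists (`|set_val x 0%N - set_val y 0%N| / 2 ^+ 0); exists 0%N.
by exists 1 => _ [n _ <-]; exact: term_le1.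
Qed.

Lemma hilbert_dist_ub x y n :
  `|set_val x n - set_val y n| / 2 ^+ n <= hilbert_dist x y.
Proof. by apply: (sup_upper_bound (has_sup_term x y)); exists n. Qed.

Lemma hilbert_dist_le x y c :
  (forall n, `|set_val x n - set_val y n| / 2 ^+ n <= c) ->
  hilbert_dist x y <= c.
Proof.
move=> H; apply: ge_sup; first by case: (has_sup_term x y).
by move=> _ [n _ <-]; exact: H.
Qed.

Let dist_ge0 x y : 0 <= hilbert_dist x y.
Proof. by apply: le_trans (hilbert_dist_ub x y 0%N); rewrite divr_ge0. Qed.

Let distxx x : hilbert_dist x x = 0.
Proof.
apply/eqP; rewrite eq_le dist_ge0 andbT; apply: hilbert_dist_le => n.
by rewrite subrr normr0 mul0r.
Qed.

Let dist_sym x y : hilbert_dist x y = hilbert_dist y x.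
Proof.
by congr (sup (_ @` _)); apply/funext => n; rewrite distrC.
Qed.

Let dist_triangle y x z :
  hilbert_dist x z <= hilbert_dist x y + hilbert_dist y z.
Proof.
apply: hilbert_dist_le => n.
apply: le_trans (lerD (hilbert_dist_ub x y n) (hilbert_dist_ub y z n)).
rewrite -mulrDl ler_pM2r ?invr_gt0 ?exprn_gt0 //.
exact: ler_distD.
Qed.

Let dist_positivity x y : hilbert_dist x y = 0 -> x = y.
Proof.
move=> d0; apply: val_inj; apply/funext => n; apply/eqP.
rewrite -subr_eq0 -normr_eq0 eq_le normr_ge0 andbT.
have := hilbert_dist_ub x y n; rewrite d0 ler_pdivrMr ?mul0r // exprn_gt0.
Qed.

Let hilbert_ball x (e : R) : set (hilbert_cube R) :=
  [set y | hilbert_dist x y < e].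

Let ball_center x e : 0 < e -> hilbert_ball x e x.
Proof. by rewrite /hilbert_ball /= distxx. Qed.

Let ball_sym x y e : hilbert_ball x e y -> hilbert_ball y e x.
Proof. by rewrite /hilbert_ball /= dist_sym. Qed.

Let ball_triangle x y z e1 e2 :
  hilbert_ball x e1 y -> hilbert_ball y e2 z -> hilbert_ball x (e1 + e2) z.
Proof.
by rewrite /hilbert_ball /= => h1 h2; apply: le_lt_trans (ltrD h1 h2).
Qed.

Let coord_entourage n (e : R) : 0 < e ->
  entourage [set xy : hilbert_cube R * hilbert_cube R |
    `|set_val xy.1 n - set_val xy.2 n| < e].
Proof.
move=> e0.
pose B := [set uv : R * R | `|uv.1 - uv.2| < e].
have eB : entourage B by rewrite -entourage_ballE; exists e.
pose V := [set uv : prod_topology (fun _ : nat => R) *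
                     prod_topology (fun _ : nat => R) | B (uv.1 n, uv.2 n)].
exists V; last by [].
have eV : `[< @entourage (initial_topology (@proj nat (fun=> R) n)) V >].
  by apply/asboolP; exists B.
exists V => //.
exact: (finI_from1 _ (I : setT (exist _ ((n : {classic nat}), V) eV))).
Qed.

Let filter_ball : Filter (entourage_ hilbert_ball).
Proof.
apply: filter_from_filter; first by exists 1 => /=.
move=> e1 e2 e10 e20; exists (Num.min e1 e2); first by rewrite /= lt_min e10.
by move=> xy /=; rewrite /hilbert_ball /= lt_min => /andP[].
Qed.

Let coord_ball n (e : R) : 0 < e ->
  entourage_ hilbert_ball [set xy | `|set_val xy.1 n - set_val xy.2 n| < e].
Proof.
move=> e0; have p2 : 0 < 2 ^+ n :> R by rewrite exprn_gt0.
exists (e / 2 ^+ n); first by rewrite /= divr_gt0.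
move=> [x y] /= /(le_lt_trans (hilbert_dist_ub x y n)).
by rewrite ltr_pM2r // invr_gt0.
Qed.

Let ball_entourageE : entourage = entourage_ hilbert_ball.
Proof.
rewrite eqEsubset; split => E.
  move=> [V [W [F _ <-] FV] VE].
  have : entourage_ hilbert_ball (\bigcap_(p in [set` F])
      [set xy | (projT1 p).2 (set_val xy.1, set_val xy.2)]).
    apply: (@filter_bigI _ _ _ _ _ filter_ball) => -[[n U] /= /asboolP[B +] BU] _.
    rewrite -entourage_ballE => -[e e0 eB].
    apply: (@filterS _ _ filter_ball) (coord_ball n e0) => -[x y] /= xy.
    by apply/BU/eB.
  by apply: (@filterS _ _ filter_ball) => -[x y] xy; apply/VE/FV.
move=> [e e0 eE].
have [N Ne] : exists N, (2 ^+ N)^-1 < e.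
  exists (Num.bound e^-1); rewrite invf_plt ?posrE ?exprn_gt0 //.
  apply: lt_le_trans (archi_boundP _) _; first by rewrite invr_ge0 ltW.
  by rewrite -natrX ler_nat ltnW // ltn_expl.
have e2 : 0 < e / 2 by rewrite divr_gt0.
have : entourage [set xy : hilbert_cube R * hilbert_cube R |
    forall n, (n < N)%N -> `|set_val xy.1 n - set_val xy.2 n| < e / 2].
  elim: N {Ne} => [|N IH]; first by apply: filterS filterT.
  apply: filterS (filterI IH (coord_entourage N e2)) => xy [H1 H2] n.
  by rewrite ltnS leq_eqVlt => /predU1P[->//|]; exact: H1.
apply: filterS => -[x y] /= H; apply: eE; rewrite /hilbert_ball /=.
apply: (@le_lt_trans _ _ (Num.max (e / 2) (2 ^+ N)^-1)); last first.
  by rewrite gt_max Ne andbT ltr_pdivrMr // ltr_pMr // ltr1n.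
apply: hilbert_dist_le => n; rewrite le_max.
have p2 : 1 <= 2 ^+ n :> R by rewrite exprn_ege1 // ler1n.
have p0 : 0 < 2 ^+ n :> R by rewrite exprn_gt0.
have [nN|Nn] := ltnP n N.
  apply/orP; left; apply: le_trans (ltW (H n nN)).
  by rewrite ler_pdivrMr // ler_peMr.
apply/orP; right; apply: (@le_trans _ _ (2 ^+ n)^-1).
  rewrite -[leRHS]mul1r ler_pM2r ?invr_gt0 //.
  move: (coord01 x n) (coord01 y n) => /andP[? ?] /andP[? ?].
  by rewrite ler_norml; apply/andP; split; lra.
by rewrite lef_pV2 ?posrE ?exprn_gt0 // ler_eXn2l // ltr1n.
Qed.

HB.instance Definition _ := Uniform_isPseudoMetric.Build R (hilbert_cube R)
  ball_center ball_sym ball_triangle ball_entourageE.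

Let ballEdist x d : ball x d = [set y | hilbert_dist x y < d].
Proof. by []. Qed.

HB.instance Definition _ := PseudoMetric_isMetric.Build R (hilbert_cube R)
  dist_ge0 dist_positivity ballEdist.

End hilbert_cube_metric.

Section hyperspace.
Context {R : realType} (T : metricType R).

Record hyperspace := Hyperspace {
  hyperspace_set :> set T ;
  hyperspace_compact : compact hyperspace_set ;
  hyperspace_neq0 : hyperspace_set !=set0 }.

Arguments hyperspace_compact : clear implicits.
Arguments hyperspace_neq0 : clear implicits.

HB.instance Definition _ := gen_eqMixin hyperspace.
HB.instance Definition _ := gen_choiceMixin hyperspace.

(* Open e-neighbourhood of A; the Hausdorff distance is the infimum of the e > 0
   such that each set lies in the e-neighbourhood of the other. *)
Definition thickening (A : set T) (e : R) : set T :=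
  [set x | exists2 a, A a & mdist a x < e].

Definition hausdorff_dist (A B : hyperspace) : R :=
  inf [set e | [/\ 0 < e, A `<=` thickening B e & B `<=` thickening A e]].

Implicit Types A B C : hyperspace.

Lemma thickening_le (A : set T) e1 e2 :
  e1 <= e2 -> thickening A e1 `<=` thickening A e2.
Proof. by move=> e12 x [a Aa ax]; exists a => //; exact: lt_le_trans e12. Qed.

Lemma thickeningD (A : set T) (B : set T) (C : set T) e1 e2 :
  A `<=` thickening B e1 -> B `<=` thickening C e2 ->
  A `<=` thickening C (e1 + e2).
Proof.
move=> AB BC x /AB[b /BC[c Cc cb] bx]; exists c => //.
by rewrite addrC; apply: le_lt_trans (metric_triangle _ b _) (ltrD cb bx).
Qed.

Lemma hyperspace_thickening A B : exists2 e, 0 < e & A `<=` thickening B e.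
Proof.
have [b Bb] := hyperspace_neq0 B.
have /compact_near_coveringP/(_ nat \oo (fun n x => mdist b x < n%:R)) :=
  hyperspace_compact A.
case=> [x Ax|n _ /(_ n (leqnn n)) An].
  exists (ball x 1, [set n | (Num.bound (mdist b x + 1) <= n)%N]).
    by split; [exact: nbhsx_ballx|exists (Num.bound (mdist b x + 1))].
  move=> [y n] /= [+ xn]; rewrite ballEmdist /= => xy.
  apply: le_lt_trans (metric_triangle _ x _) _.
  apply: (@lt_le_trans _ _ (mdist b x + 1)); first by rewrite ltrD2l.
  apply: le_trans (ltW (archi_boundP _)) _; last by rewrite ler_nat.
  by rewrite addr_ge0 // mdist_ge0.
exists n.+1%:R => // x /An /= bx; exists b => //.
by apply: lt_le_trans bx _; rewrite ler_nat.
Qed.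

Let has_inf_dist A B :
  has_inf [set e | [/\ 0 < e, A `<=` thickening B e & B `<=` thickening A e]].
Proof.
split; last by exists 0 => e [/ltW].
have [e e0 eAB] := hyperspace_thickening A B.
have [f f0 fBA] := hyperspace_thickening B A.
exists (Num.max e f); split; first by rewrite lt_max e0.
- by apply: subset_trans eAB (thickening_le _); rewrite le_max lexx.
- by apply: subset_trans fBA (thickening_le _); rewrite le_max lexx orbT.
Qed.

Lemma hausdorff_dist_lt A B e : hausdorff_dist A B < e ->
  [/\ 0 < e, A `<=` thickening B e & B `<=` thickening A e].
Proof.
move=> /(inf_lt (proj1 (has_inf_dist A B)))[d [d0 AB BA] /ltW de].
split; first exact: lt_le_trans de.
- exact: subset_trans AB (thickening_le de).
- exact: subset_trans BA (thickening_le de).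
Qed.

Lemma hausdorff_dist_le A B e : 0 < e ->
  A `<=` thickening B e -> B `<=` thickening A e -> hausdorff_dist A B <= e.
Proof.
by move=> e0 AB BA; apply: (ge_inf (proj2 (has_inf_dist A B))).
Qed.

Let dist_ge0 A B : 0 <= hausdorff_dist A B.
Proof. by apply: lb_le_inf; [case: (has_inf_dist A B)|move=> e [/ltW]]. Qed.

Let distxx A : hausdorff_dist A A = 0.
Proof.
apply/eqP; rewrite eq_le dist_ge0 andbT; apply/ler_addgt0Pl => e e0.
by rewrite addr0; apply: hausdorff_dist_le => // x Ax; exists x => //;
  rewrite mdistxx.
Qed.

Let dist_sym A B : hausdorff_dist A B = hausdorff_dist B A.
Proof.
by congr inf; apply/seteqP; split => e [].
Qed.

Let dist_triangle B A C :
  hausdorff_dist A C <= hausdorff_dist A B + hausdorff_dist B C.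
Proof.
apply/ler_addgt0Pl => e e0; rewrite addrC (splitr e) addrACA.
have e2 : 0 < e / 2 by rewrite divr_gt0.
have [d0 AB BA] : [/\ 0 < hausdorff_dist A B + e / 2,
    A `<=` thickening B (hausdorff_dist A B + e / 2) &
    B `<=` thickening A (hausdorff_dist A B + e / 2)].
  by apply: hausdorff_dist_lt; rewrite ltrDl.
have [f0 BC CB] : [/\ 0 < hausdorff_dist B C + e / 2,
    B `<=` thickening C (hausdorff_dist B C + e / 2) &
    C `<=` thickening B (hausdorff_dist B C + e / 2)].
  by apply: hausdorff_dist_lt; rewrite ltrDl.
apply: hausdorff_dist_le; first exact: addr_gt0.
- exact: thickeningD AB BC.
- by rewrite addrC; exact: thickeningD CB BA.
Qed.

Let hyperspace_inj A B : A = B :> set T -> A = B.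
Proof.
case: A B => [A cA A0] [B cB B0] /= AB; subst B.
by rewrite (Prop_irrelevance cA cB) (Prop_irrelevance A0 B0).
Qed.

Let hyperspace_closed A : closed A.
Proof. exact: compact_closed (@metric_hausdorff R T) (hyperspace_compact A). Qed.

Let dist0_sub A B : hausdorff_dist A B = 0 -> A `<=` B.
Proof.
move=> d0 x Ax; apply: hyperspace_closed => U /nbhs_ballP[e /= e0 eU].
have [_ /(_ _ Ax)[b Bb bx] _] : [/\ 0 < e, A `<=` thickening B e &
  B `<=` thickening A e] by apply: hausdorff_dist_lt; rewrite d0.
by exists b; split => //; apply: eU; rewrite ballEmdist /= metric_sym.
Qed.

Let dist_positivity A B : hausdorff_dist A B = 0 -> A = B.
Proof.
move=> d0; apply: hyperspace_inj; apply/seteqP; split; first exact: dist0_sub.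
by apply: dist0_sub; rewrite dist_sym.
Qed.

HB.instance Definition _ := isMetric.Build R hyperspace
  distxx dist_positivity dist_sym dist_triangle.

End hyperspace.

Definition borel_sets (T : topologicalType) : set (set T) := <<s @open T >>.

(* SX and SY are the Borel structures of X and Y; they are arguments because
   the domain will carry the trace of a sigma-algebra on a larger space, and
   library measurable types are required to be pointed. *)
Definition borel_reducible (X Y : Type) (SX : set (set X)) (SY : set (set Y))
    (E : X -> X -> Prop) (F : Y -> Y -> Prop) : Prop :=
  exists f : X -> Y,
    (forall B, SY B -> SX (f @^-1` B)) /\
    (forall x x', E x x' <-> F (f x) (f x')).

Record language := Language { symbol : countType; arity : symbol -> nat }.

(* Structures with underlying set nat: the product over the symbols s of L of
   2 ^ (nat ^ arity s), with the product topology (bool discrete). *)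
Definition nat_structure (L : language) : topologicalType :=
  prod_topology (fun s : symbol L => {ptws (arity s).-tuple nat -> bool}).

Definition nat_structure_iso (L : language) (M N : nat_structure L) : Prop :=
  exists2 g : nat -> nat, bijective g &
    forall (s : symbol L) (t : (arity s).-tuple nat),
      M s t = N s (map_tuple g t).

Definition classifiable_by_countable_structures
    (X : Type) (SX : set (set X)) (E : X -> X -> Prop) : Prop :=
  exists L : language,
    borel_reducible SX (@borel_sets (nat_structure L)) E (@nat_structure_iso L).

Definition homeomorphic (X Y : topologicalType) : Prop :=
  exists (f : X -> Y) (g : Y -> X),
    [/\ cancel f g, cancel g f, continuous f & continuous g].

Definition boundary (X : topologicalType) (U : set X) : set X :=
  closure U `\` U°.

Definition rim_finite (X : topologicalType) : Prop :=
  exists2 B : set (set X), basis B & forall U, B U -> finite_set (boundary U).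

(* A class C of spaces is coded by C /\ 2^Q: each K in 2^Q is viewed as a space
   with the subspace topology, and coded_borel is the trace on the class of the
   Borel sigma-algebra of 2^Q. *)
Section coded_class.
Variables (R : realType) (C : topologicalType -> Prop).

Definition coded_class : set (hyperspace (hilbert_cube R)) :=
  [set K : hyperspace (hilbert_cube R) | C (set_type K)].

Definition coded_borel : set (set (set_type coded_class)) :=
  preimage_set_system setT set_val (@borel_sets (hyperspace (hilbert_cube R))).

Definition coded_homeomorphic (K K' : set_type coded_class) : Prop :=
  homeomorphic (set_type (set_val K)) (set_type (set_val K')).

End coded_class.

Arguments coded_class : clear implicits.
Arguments coded_borel : clear implicits.
Arguments coded_homeomorphic : clear implicits.

(* Main.v *)
Require Import Defs.
From mathcomp Require Import all_boot all_order all_algebra.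
From mathcomp Require Import zify lra.
From mathcomp Require Import all_classical all_reals all_analysis.
Set Implicit Arguments.
Unset Strict Implicit.
Unset Printing Implicit Defensive.
Import Order.TTheory GRing.Theory Num.Theory.
Import numFieldNormedType.Exports.

(* A sequence x of integers with 0 <= x n <= 2^n codes a compactum [fan x]: the
   arc [0,1] approached by disjoint small arcs, the n-th one at position
   x n / 2^n and carrying exactly n limits of isolated points as a label that
   every homeomorphism respects.  If |x n - y n| <= 1 for all n, then sliding
   the small arcs is a homeomorphism from fan x to fan y, whereas fan x and
   fan y are not homeomorphic when, for infinitely many n, the n-th arcs sit at
   opposite ends of [0,1], and for infinitely many other n at the same end 0.

   On the other side, following Hjorth's turbulence argument, if a Borel map M
   from sequences to countable structures satisfies M x ~ M y whenever x and y
   differ by at most 1 everywhere, then M x ~ M y for comeagerly many pairs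
   (x, y).  By induction on the construction of back-and-forth relations R, a
   tuple whose R-type is generically unchanged by bounded moves of x has a
   generically constant R-type: a Baire category argument makes the types of
   its one-point extensions invariant under bounded moves on a smaller open
   set, and bounded moves connect any two finite sequences. *)

(** * Baire category on spaces of sequences *)

Lemma prefix_map (T T' : eqType) (p : T -> T') s t :
  prefix s t -> prefix (map p s) (map p t).
Proof. by move=> /prefixP[u ->]; rewrite map_cat prefix_prefix. Qed.

Section Branch.
Variables (T : countType) (I : countType).
Implicit Types (s t u : seq T) (z : nat -> T).

Lemma prefix_mkseq z m n : m <= n -> prefix (mkseq z m) (mkseq z n).
Proof.
move=> mn; apply/prefixP; exists (map z (iota m (n - m))).
by rewrite /mkseq -map_cat -{1}[m in iota m _]add0n -iotaD subnKC.
Qed.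

Lemma prefix_mkseqE z t n : prefix t (mkseq z n) -> t = mkseq z (size t).
Proof.
rewrite prefixE => /eqP <-; rewrite size_take size_mkseq.
rewrite /mkseq -map_take take_iota; congr (map _ (iota _ _)).
Qed.

Lemma chain_branch (S : nat -> seq T) (x0 : T) :
  (forall k, prefix (S k) (S k.+1)) -> (forall k, k <= size (S k)) ->
  exists z, forall k, S k = mkseq z (size (S k)).
Proof.
move=> SS Sk; have Sle k l : k <= l -> prefix (S k) (S l).
  elim: l => [|l IH]; first by rewrite leqn0 => /eqP->; apply: prefix_refl.
  rewrite leq_eqVlt ltnS => /predU1P[->|/IH h]; first exact: prefix_refl.
  exact: prefix_trans h (SS l).
exists (fun n => nth x0 (S n.+1) n) => k.
apply: (@eq_from_nth _ x0); rewrite ?size_mkseq // => i ik.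
rewrite nth_mkseq //; case/orP: (leq_total k i.+1) => h.
  by have /prefixP[v ->] := Sle _ _ h; rewrite nth_cat ik.
by have /prefixP[v ->] := Sle _ _ h; rewrite nth_cat (leq_trans _ (Sk i.+1)).
Qed.

Lemma generic_branch (G : seq T -> Prop) (D : I -> seq T -> Prop) s :
  G s ->
  (forall t, G t -> exists a, G (rcons t a)) ->
  (forall i t, prefix s t -> G t -> exists u, [/\ G u, prefix t u & D i u]) ->
  exists z, [/\ mkseq z (size s) = s,
    forall n, exists m, n <= m /\ G (mkseq z m) &
    forall i, exists n, D i (mkseq z n)].
Proof.
move=> Gs Gr dense.
(* [None] stands for a code of no requirement: such a stage only lengthens the sequence. *)
pose next_spec (ot : option I * seq T) u := prefix s ot.2 -> G ot.2 ->
  [/\ G u, prefix ot.2 u, size ot.2 < size u &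
    (if ot.1 is Some i then exists v, prefix v u /\ D i v else True)].
have /boolp.choice[next nextP] : forall ot, exists u, next_spec ot u.
  move=> [oi t]; case: (pselect (prefix s t /\ G t)) => [[st Gt]|nG];
    last first.
    by exists [::] => ? ?; case: nG.
  case: oi => [i|]; last first.
    have [a Ga] := Gr t Gt; exists (rcons t a) => _ _ /=; split => //.
      exact: prefix_rcons.
    by rewrite size_rcons.
  have [u [Gu tu Du]] := dense i t st Gt.
  have [a Ga] := Gr u Gu; exists (rcons u a) => _ _ /=; split => //.
  - exact: prefix_trans tu (prefix_rcons _ _).
  - by rewrite size_rcons ltnS size_prefix.
  - by exists u; split => //; exact: prefix_rcons.
pose S := fix S k := if k is k'.+1 then next (unpickle k', S k') else s.
have SP k : prefix s (S k) /\ G (S k).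
  elim: k => [|k [sS GS]]; first by split=> //; exact: prefix_refl.
  by have /= [? h _ _] := nextP (unpickle k, S k) sS GS; split => //;
    exact: prefix_trans h.
have SN k := nextP (unpickle k, S k) (SP k).1 (SP k).2.
have Ssz k : k <= size (S k).
  by elim: k => // k IH; have /= [_ _ + _] := SN k; apply: leq_ltn_trans.
have [x0 _] := Gr s Gs.
have [|z Sz] := chain_branch x0 _ Ssz; first by move=> k; have /= [] := SN k.
exists z; split.
- by rewrite [RHS](Sz 0).
- by move=> n; exists (size (S n)); split=> //; rewrite -Sz; case: (SP n).
- move=> i; have /= [_ _ _] := SN (pickle i).
  rewrite -[next _]/(S (pickle i).+1) pickleK => -[v [vS Dv]]; exists (size v).
  by move: vS; rewrite (Sz (pickle i).+1) => /prefix_mkseqE vz; rewrite -vz.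
Qed.

End Branch.

(* [force S s A]: the set [A] is comeager in the basic open set of the space
   [S^nat] (with [S] discrete) determined by the finite sequence [s]. *)
Definition force (T : countType) (S : pred T) (s : seq T)
    (A : (nat -> T) -> Prop) : Prop :=
  exists D : nat -> seq T -> Prop,
    (forall k t, all S t -> prefix s t ->
       exists u, [/\ all S u, prefix t u & D k u]) /\
    (forall z, (forall n, S (z n)) -> mkseq z (size s) = s ->
       (forall k, exists n, D k (mkseq z n)) -> A z).

Section Force.
Variables (T : countType) (S : pred T).
Implicit Types (s t u : seq T) (A B : (nat -> T) -> Prop).

Lemma force_fam (I : countType) s A (D : I -> seq T -> Prop) :
  (forall i t, all S t -> prefix s t ->
     exists u, [/\ all S u, prefix t u & D i u]) ->
  (forall z, (forall n, S (z n)) -> mkseq z (size s) = s ->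
     (forall i, exists n, D i (mkseq z n)) -> A z) ->
  force S s A.
Proof.
move=> dD DA.
exists (fun k u => if unpickle k is Some i then D i u else True); split.
  move=> k t St st; case: (unpickle k) => [i|]; first exact: dD.
  by exists t; split => //; exact: prefix_refl.
move=> z Sz zs H; apply: DA => // i.
by have [n] := H (pickle i); rewrite pickleK => ?; exists n.
Qed.

Lemma force_const s A : (forall z, (forall n, S (z n)) -> A z) -> force S s A.
Proof.
move=> H; exists (fun _ _ => True); split => [_ t St _|z /H //].
by exists t; split => //; exact: prefix_refl.
Qed.

Lemma force_mono s A B :
  (forall z, (forall n, S (z n)) -> A z -> B z) -> force S s A -> force S s B.
Proof.
by move=> AB [D [dD DA]]; exists D; split => // z Sz zs H; apply: AB => //;
  apply: DA.
Qed.

Lemma force_ext s t A : prefix s t -> force S s A -> force S t A.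
Proof.
move=> st [D [dD DA]]; exists D; split => [k u Su tu|z Sz zt H].
  exact: dD Su (prefix_trans st tu).
apply: DA => //; have : prefix s (mkseq z (size t)) by rewrite zt.
by move/prefix_mkseqE.
Qed.

Lemma force_bigcap (I : countType) s (A : I -> (nat -> T) -> Prop) :
  (forall i, force S s (A i)) -> force S s (fun z => forall i, A i z).
Proof.
move=> /boolp.choice[D HD].
apply: (@force_fam (I * nat)%type _ _ (fun p => D p.1 p.2)) =>
  [[i k] /=|z Sz zs H i].
  exact: (HD i).1.
by apply: (HD i).2 => // k; have := H (i, k).
Qed.

Lemma force_and s A B :
  force S s A -> force S s B -> force S s (fun z => A z /\ B z).
Proof.
move=> fA fB; have : force S s (fun z => forall b :
  bool, if b then A z else B z).
  by apply: force_bigcap => -[].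
by apply: force_mono => z _ H; split; [exact: (H true)|exact: (H false)].
Qed.

(** Comeagerness is local: a generic sequence passes through some [u] forcing [A], and from there
    the dense sets attached to [u] put it in [A]. *)
Lemma force_dense s A :
  (forall t, all S t -> prefix s t ->
     exists u, [/\ all S u, prefix t u & force S u A]) -> force S s A.
Proof.
move=> H.
have /boolp.choice[D HD] : forall u, exists D : nat -> seq T -> Prop,
    force S u A ->
    (forall k t, all S t -> prefix u t ->
       exists v, [/\ all S v, prefix t v & D k v]) /\
    (forall z, (forall n, S (z n)) -> mkseq z (size u) = u ->
       (forall k, exists n, D k (mkseq z n)) -> A z).
  move=> u; case: (pselect (force S u A)) => [[D HD]|nf]; first by exists D.
  by exists (fun _ _ => True).
(* [None] asks to pass through some [u] that forces [A]; [Some (u, k)] asks to meet the [k]-th dense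
   set of [u] or to leave [u]. *)
pose E (o : option (seq T * nat)) (v : seq T) : Prop :=
  if o is Some (u, k) then
    force S u A -> all S u -> D u k v \/ ~~ (prefix u v || prefix v u)
  else exists u, force S u A /\ prefix u v.
apply: (@force_fam _ _ _ E) => [[[u k]|] t St st /=|z Sz zs Hz].
- case: (pselect (force S u A /\ all S u)) => [[fu Su]|nf]; last first.
    by exists t; split => //; [exact: prefix_refl|move=> ? ?; case: nf].
  have [put|nput] := boolP (prefix u t).
    have [v [Sv tv Dv]] := (HD u fu).1 k t St put.
    by exists v; split => //; left.
  have [ptu|nptu] := boolP (prefix t u).
    have [v [Sv uv Dv]] := (HD u fu).1 k u Su (prefix_refl u).
    by exists v; split => //; [exact: prefix_trans uv|left].
  exists t; split => //; first exact: prefix_refl.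
  by move=> _ _; right; rewrite negb_or nput.
- have [u [Su tu fu]] := H t St st; exists u; split => //.
  by exists u; split => //; exact: prefix_refl.
- have [n [u [fu /prefix_mkseqE uz]]] := Hz None.
  apply: ((HD u fu).2 z Sz) => [//|k]; have [m /=] := Hz (Some (u, k)).
  have Su : all S u by rewrite uz; apply/allP => _ /mapP[i _ ->]; exact: Sz.
  move=> /(_ fu Su)[?|]; first by exists m.
  rewrite uz; case/orP: (leq_total (size u) m) => h.
    by rewrite prefix_mkseq.
  by rewrite orbC prefix_mkseq.
Qed.

(** This is the Baire category theorem for [S^nat]; the element [a] lets finite sequences be
    prolonged inside [S]. *)
Lemma force_sat s A : all S s -> (exists a, S a) -> force S s A ->
  exists z, [/\ forall n, S (z n), mkseq z (size s) = s & A z].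
Proof.
move=> Ss [a Sa] [D [dD DA]].
have Gr (t : seq T) : all S t -> exists b, all S (rcons t b).
  by move=> St; exists a; rewrite all_rcons Sa.
have [|z [zs zG zD]] := @generic_branch T nat (all S) D s Ss Gr _.
  by move=> i t st St; exact: dD.
have Sz n : S (z n).
  have [m [nm /allP]] := zG n.+1; apply.
  by apply/mapP; exists n; rewrite // mem_iota.
by exists z; split => //; exact: DA.
Qed.

End Force.

Section Coordinatewise.
Variables (T T' : countType) (S : pred T) (S' : pred T') (p : T -> T').
Hypothesis Sp : forall t, S t -> S' (p t).
Hypothesis pS : forall t', S' t' -> exists2 t, S t & p t = t'.

Lemma all_map_coord (t : seq T) : all S t -> all S' (map p t).
Proof. by move=> /allP St; apply/allP => _ /mapP[a /St/Sp ? ->]. Qed.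

Lemma lift_seq (t' : seq T') : all S' t' -> exists2 t, all S t & map p t = t'.
Proof.
elim: t' => [|a t' IH] /=; first by exists [::].
move=> /andP[/pS[b Sb <-] /IH[t St <-]].
by exists (b :: t); rewrite //= Sb.
Qed.

(** Applying [p] coordinatewise is an open map, since by [pS] extensions of [map p t] lift to
    extensions of [t]. Hence preimages of comeager sets are comeager. *)
Lemma force_pullback (s : seq T) A :
  force S' (map p s) A -> force S s (fun z => A (p \o z)).
Proof.
move=> [D [dD DA]]; exists (fun k u => D k (map p u)); split.
  move=> k t St /prefixP[t1 et].
  have pst : prefix (map p s) (map p t) by rewrite prefix_map // et
    prefix_prefix.
  have [u' [Su' /prefixP[v' eu] Du]] := dD k _ (all_map_coord St) pst.
  move: Su' Du; rewrite eu all_cat => /andP[_ /lift_seq[v Sv <-]].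
  rewrite -map_cat => Du; exists (t ++ v).
  by rewrite all_cat St prefix_prefix.
move=> z Sz zs H; apply: DA => [n||k].
- exact: Sp.
- by rewrite size_map -[in RHS]zs /mkseq -map_comp.
- by have [n] := H k; rewrite /mkseq -map_comp; exists n.
Qed.

(** Over a generic [z'], a preimage [z] in [A] is built by [generic_branch] among the finite lifts
    of prefixes of [z']. *)
Lemma force_push (s : seq T) A : all S s ->
  force S s A ->
  force S' (map p s) (fun z' =>
    exists z, [/\ forall n, S (z n), A z & p \o z =1 z']).
Proof.
move=> Ss [D [dD DA]].
(* The requirement [(k, t)] makes [z'] either leave [map p t] or pass through the image of an
   extension of [t] in [D k], so that a lift [t] of a prefix of [z'] can always be continued into
   [D k]. *)
pose E (o : nat * seq T) (v' : seq T') : Prop :=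
  (all S o.2 /\ prefix s o.2) ->
  (exists u, [/\ all S u, prefix o.2 u, D o.1 u & prefix (map p u) v']) \/
  ~~ (prefix (map p o.2) v' || prefix v' (map p o.2)).
apply: (@force_fam _ _ _ _ _ E) => [[k t] t' St' st'|z' Sz' zs' Hz].
  rewrite /E /=; case: (pselect (all S t /\ prefix s t)) => [[St st]|n];
    last first.
    by exists t'; split => //; exact: prefix_refl.
  have [tt'|ntt'] := boolP (prefix (map p t) t').
    move: tt' St' => /prefixP[v' ->];
      rewrite all_cat => /andP[_ /lift_seq[v Sv <-]].
    have [] := dD k (t ++ v); rewrite ?all_cat ?St //.
      exact: prefix_catl.
    move=> u [Su tvu Du]; exists (map p u); split; first exact: all_map_coord.
      by rewrite -map_cat; exact: prefix_map.
    move=> _; left; exists u; split => //; last exact: prefix_refl.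
    exact: catl_prefix tvu.
  have [t't|nt't] := boolP (prefix t' (map p t)).
    have [u [Su tu Du]] := dD k t St st; exists (map p u); split.
    - exact: all_map_coord.
    - apply: prefix_trans t't _.
      exact: prefix_map.
    - by move=> _; left; exists u; split => //; exact: prefix_refl.
  exists t'; split => //; first exact: prefix_refl.
  by move=> _; right; rewrite negb_or ntt'.
pose G (t : seq T) := all S t /\ map p t = mkseq z' (size t).
have Gs : G s by split => //; rewrite -zs' size_map.
have Gr t : G t -> exists a, G (rcons t a).
  move=> [St pt]; have [a Sa pa] := pS (Sz' (size t)); exists a; split.
    by rewrite all_rcons Sa.
  by rewrite map_rcons pt pa size_rcons mkseqS.
have [|z [zs zG zD]] := @generic_branch T nat G D s Gs Gr _.
  move=> k t st [St pt]; have [n] := Hz (k, t);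
    rewrite /E /= => /(_ (conj St st)).
  case=> [[u [Su tu Du pu]]|]; last first.
    rewrite pt; case/orP: (leq_total (size t) n) => h.
      by rewrite prefix_mkseq.
    by rewrite orbC prefix_mkseq.
  exists u; split => //; split => //.
  by rewrite (prefix_mkseqE pu) size_map.
have zGn n : S (z n) /\ p (z n) = z' n.
  have [m [nm [/allP Sm pm]]] := zG n.+1; split.
    by apply: Sm; apply/mapP; exists n; rewrite // mem_iota.
  move: pm; rewrite size_mkseq /mkseq -map_comp => /eq_in_map; apply.
  by rewrite mem_iota.
exists z; split => [n||n]; [by case: (zGn n)| |by case: (zGn n)].
by apply: DA => // n; case: (zGn n).
Qed.

End Coordinatewise.

(** * Borel sets of sequences and the Baire property *)

Inductive borel (T : Type) : ((nat -> T) -> Prop) -> Prop :=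
| borel_coord n (P : T -> Prop) : borel (fun z => P (z n))
| borel_compl A : borel A -> borel (fun z => ~ A z)
| borel_bigcup (A : nat -> (nat -> T) -> Prop) :
    (forall n, borel (A n)) -> borel (fun z => exists n, A n z).

Section Borel.
Variable T : Type.
Implicit Types A B : (nat -> T) -> Prop.

Lemma borel_ext A B : (forall z, A z <-> B z) -> borel A -> borel B.
Proof. by move=> AB; have -> : A = B by apply/funext => z; apply/propext. Qed.

Lemma borel_const (P : Prop) : borel (fun _ : nat -> T => P).
Proof. exact: (borel_coord 0 (fun=> P)). Qed.

Lemma borel_exists (I : countType) (A : I -> (nat -> T) -> Prop) :
  (forall i, borel (A i)) -> borel (fun z => exists i, A i z).
Proof.
move=> bA.
apply: (@borel_ext (fun z =>
  exists n, if unpickle n is Some i then A i z else False)).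
  move=> z; split=> [[n]|[i Ai]]; last by exists (pickle i); rewrite pickleK.
  by case: (unpickle n) => // i; exists i.
by apply: borel_bigcup => n; case: (unpickle n) => [i|] //; exact: borel_const.
Qed.

Lemma borel_forall (I : countType) (A : I -> (nat -> T) -> Prop) :
  (forall i, borel (A i)) -> borel (fun z => forall i, A i z).
Proof.
move=> bA; apply: (@borel_ext (fun z => ~ exists i, ~ A i z)).
  move=> z; split => [h i|h [i]]; last by apply.
  by apply: contrapT => nA; apply: h; exists i.
by apply: borel_compl; apply: borel_exists => i; exact: borel_compl.
Qed.

Lemma borel_or A B : borel A -> borel B -> borel (fun z => A z \/ B z).
Proof.
move=> bA bB; apply: (@borel_ext (fun z => exists b :
  bool, if b then A z else B z)).
  move=> z; split=> [[[]]|[]];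
    [by left|by right|by exists true|by exists false].
by apply: borel_exists => -[].
Qed.

Lemma borel_and A B : borel A -> borel B -> borel (fun z => A z /\ B z).
Proof.
move=> bA bB; apply: (@borel_ext (fun z => forall b :
  bool, if b then A z else B z)).
  move=> z; split=> [h|[a b] []] //; by split;
    [exact: (h true)|exact: (h false)].
by apply: borel_forall => -[].
Qed.

Lemma borel_imply A B : borel A -> borel B -> borel (fun z => A z -> B z).
Proof.
move=> bA bB; apply: (@borel_ext (fun z => ~ A z \/ B z)).
  move=> z; split=> [[]//|h]; case: (pselect (A z)) => [/h|];
    [by right|by left].
exact: borel_or (borel_compl bA) bB.
Qed.

Lemma borel_iff A B : borel A -> borel B -> borel (fun z => A z <-> B z).
Proof. by move=> bA bB; apply: borel_and; apply: borel_imply. Qed.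

Lemma borel_pullback (T' : Type) (p : T' -> T) A :
  borel A -> borel (fun z : nat -> T' => A (p \o z)).
Proof.
elim=> [n P|B _ IH|B _ IH]; first exact: (borel_coord n (fun a => P (p a))).
  exact: borel_compl.
exact: borel_bigcup.
Qed.

End Borel.

Section BaireProperty.
Variables (T : countType) (S : pred T).
Hypothesis S0 : exists a, S a.
Implicit Types (s t u : seq T) (A B : (nat -> T) -> Prop).

Lemma force_contra s A : all S s -> force S s A -> ~ force S s (fun z => ~ A z).
Proof.
by move=> Ss fA fN; have [z [_ _ []]] := force_sat Ss S0 (force_and fA fN).
Qed.

(** The Baire property, by induction on Borel sets. For a union: if no extension of [s] forces one
    of the sets, then each complement is forced densely above [s], hence by [s], and so is their
    intersection. *)
Lemma borel_decide A s : borel A -> all S s ->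
  exists t, [/\ all S t, prefix s t &
    force S t A \/ force S t (fun z => ~ A z)].
Proof.
move=> bA; elim: bA s => [n P|{}A bA IH|{}A bA IH] s Ss.
(* Padding with [n.+1] letters fixes coordinate [n], which alone decides the set. *)
- have [a Sa] := S0; exists (s ++ nseq n.+1 a).
  have Sn : all S (s ++ nseq n.+1 a) by rewrite all_cat Ss all_nseq Sa orbT.
  split => //; first exact: prefix_prefix.
  pose b := nth a (s ++ nseq n.+1 a) n.
  have zb z : mkseq z (size (s ++ nseq n.+1 a)) = s ++ nseq n.+1 a -> z n = b.
    move=> /(congr1 (fun s' => nth a s' n)); rewrite nth_mkseq //.
    by rewrite size_cat size_nseq addnS ltnS leq_addl.
  have Hf (B : (nat -> T) -> Prop) :
      (forall z, z n = b -> B z) -> force S (s ++ nseq n.+1 a) B.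
    move=> HB; exists (fun _ _ => True); split => [_ t St _|z _ /zb/HB //].
    by exists t; split => //; exact: prefix_refl.
  by case: (pselect (P b)) => Pb; [left|right]; apply: Hf => z ->.
- have [t [St st h]] := IH s Ss; exists t; split => //.
  case: h => h; [right|by left].
  by apply: force_mono h => z _ Az; apply.
- case: (pselect (exists t, [/\ all S t, prefix s t & exists n,
    force S t (A n)])).
    move=> [t [St st [n fA]]]; exists t; split => //; left.
    by apply: force_mono fA => z _ ?; exists n.
  move=> nex; exists s; split => //; first exact: prefix_refl.
  right; have : force S s (fun z => forall n, ~ A n z).
    apply: force_bigcap => n; apply: force_dense => t St st.
    have [u [Su tu [fu|fu]]] := IH n t St; last by exists u.
    by case: nex; exists u; split => //; [exact: prefix_trans tu|exists n].
  by apply: force_mono => z _ H [n]; exact: H.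
Qed.

Lemma not_force s A : borel A -> all S s -> ~ force S s A ->
  exists t, [/\ all S t, prefix s t & force S t (fun z => ~ A z)].
Proof.
move=> bA Ss nf; apply: contrapT => H; apply: nf; apply: force_dense => t St st.
have [u [Su tu [fu|fu]]] := borel_decide bA St; first by exists u.
by case: H; exists u; split => //; exact: prefix_trans tu.
Qed.

(** If no extension forced a single [A i], then [s] would force all the complements, against the
    Baire category theorem. *)
Lemma force_exists (I : countType) s (A : I -> (nat -> T) -> Prop) :
  (forall i, borel (A i)) -> all S s -> force S s (fun z => exists i, A i z) ->
  exists i t, [/\ all S t, prefix s t & force S t (A i)].
Proof.
move=> bA Ss fA; apply: contrapT => H; apply: (force_contra Ss fA).
have : force S s (fun z => forall i, ~ A i z).
  apply: force_bigcap => i; apply: force_dense => t St st.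
  have [u [Su tu [fu|fu]]] := borel_decide (bA i) St; last by exists u.
  by case: H; exists i, u; split => //; exact: prefix_trans tu.
by apply: force_mono => z _ h [i]; exact: h.
Qed.

End BaireProperty.

(** * Bounded moves *)

Definition close_pair (k : nat) : pred (nat * nat) :=
  [pred t | (t.1 <= t.2 + k) && (t.2 <= t.1 + k)].

Lemma close_pairxx k a : close_pair k (a, a).
Proof. by rewrite /close_pair /= leq_addr. Qed.

Lemma all_zip_diag k (w : seq nat) : all (close_pair k) (zip w w).
Proof. by elim: w => //= a w ->; rewrite close_pairxx. Qed.

Lemma prefix_zip (T T' : eqType) (s t : seq T) (s' t' : seq T') :
  prefix s t -> prefix s' t' -> size s = size s' ->
  prefix (zip s s') (zip t t').
Proof.
by move=> /prefixP[u ->] /prefixP[u' ->] ss; rewrite zip_cat // prefix_prefix.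
Qed.

Lemma prefix_unzip1 (T T' : eqType) (w : seq T) (w' : seq T') o :
  size w = size w' ->
  prefix (zip w w') o -> prefix w (unzip1 o).
Proof.
by move=> ww' /(prefix_map fst); rewrite -/(unzip1 _) unzip1_zip ?ww'.
Qed.

Lemma prefix_unzip2 (T T' : eqType) (w : seq T) (w' : seq T') o :
  size w = size w' ->
  prefix (zip w w') o -> prefix w' (unzip2 o).
Proof.
by move=> ww' /(prefix_map snd); rewrite -/(unzip2 _) unzip2_zip ?ww'.
Qed.

Definition p12 (t : nat * nat * nat) := t.1.
Definition p13 (t : nat * nat * nat) := (t.1.1, t.2).
Definition p23 (t : nat * nat * nat) := (t.1.2, t.2).

Lemma map_p12 p q r : size p = size q -> size p = size r ->
  map p12 (zip (zip p q) r) = zip p q.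
Proof. by move=> pq pr; apply: unzip1_zip; rewrite size_zip -pq minnn pr. Qed.

Lemma map_p13 p q r : size p = size q -> size p = size r ->
  map p13 (zip (zip p q) r) = zip p r.
Proof. by elim: p q r => [|a p IH] [|b q] [|c r] //= [pq] [pr]; rewrite IH. Qed.

Lemma map_p23 p q r : size p = size q -> size p = size r ->
  map p23 (zip (zip p q) r) = zip q r.
Proof. by elim: p q r => [|a p IH] [|b q] [|c r] //= [pq] [pr]; rewrite IH. Qed.

Section Spread.
Variables (A B : (nat -> nat * nat) -> Prop) (k : nat) (w : seq nat).
Hypotheses (k0 : 0 < k) (bA : borel A).
Hypothesis fB : force (close_pair k) (zip w w) B.
Hypothesis BA : forall z : nat -> nat * nat * nat,
  B (p23 \o z) -> A (p12 \o z) -> A (p13 \o z).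

Let S3 : pred (nat * nat * nat) := [pred t | close_pair k (p23 t)].

(** Otherwise some extension of [zip p q'] forces the complement of [A]. A generic triple (x, y, y')
    with y and y' at distance at most [k] then satisfies [A] at (x, y), [B] at (y, y') and not [A]
    at (x, y'), against [BA]. *)
Lemma force_move p q q' : size q = size p -> size q' = size p ->
  prefix w p -> prefix w q -> prefix w q' -> all (close_pair k) (zip q q') ->
  force predT (zip p q) A -> force predT (zip p q') A.
Proof.
move=> sq sq' wp wq wq' nqq' fA; apply: contrapT => nfA.
have S0 : exists a : nat * nat, predT a by exists (0, 0).
have [u [_ tu fnA]] := not_force S0 bA (all_predT _) nfA.
case/prefixP: tu => v uE.
(* Beyond the length of [p] the second sequence copies the third, which keeps the two close. *)
pose tau := zip (zip p q) q' ++ [seq (a, a.2) | a <- v].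
have s3 : size (zip p q) = size q' by rewrite size_zip sq minnn sq'.
have Stau : all S3 tau.
  rewrite all_cat; apply/andP; split.
    by rewrite -(all_map p23) map_p23 // ?sq ?sq'.
  by rewrite all_map; apply/allP => a _; exact: close_pairxx.
have t0 : exists a, S3 a by exists (0, 0, 0); exact: close_pairxx.
have f12 : force S3 tau (fun z => A (p12 \o z)).
  apply: (@force_pullback _ _ S3 predT) => // [[a b] _|].
    by exists (a, b, b) => //; exact: close_pairxx.
  apply: force_ext fA; rewrite map_cat map_p12 // ?sq ?sq' //.
  exact: prefix_prefix.
have f13 : force S3 tau (fun z => ~ A (p13 \o z)).
  apply: (@force_pullback _ _ S3 predT _ _ _ _ (fun z => ~ A z)) =>
    // [[a b] _|].
    by exists (a, b, b) => //; exact: close_pairxx.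
  rewrite map_cat map_p13 ?sq ?sq' //; rewrite uE in fnA.
  suff -> : [seq p13 i | i <- [seq (a, a.2) | a <- v]] = v by [].
  by rewrite -map_comp -[RHS]map_id; apply: eq_map => -[].
have f23 : force S3 tau (fun z => B (p23 \o z)).
  apply: (@force_pullback _ _ S3 (close_pair k)) => // [[a b] nab|].
    by exists (a, a, b).
  apply: force_ext fB; rewrite map_cat map_p23 ?sq ?sq' //.
  by apply: prefix_catl; apply: prefix_zip.
have [z [_ _ [h1 [h2 h3]]]] :=
  force_sat Stau t0 (force_and f12 (force_and f13 f23)).
by apply: h2; apply: BA h3 h1.
Qed.

(** Moves [ab.1] towards [ab.2] by at most [m]; consecutive values of [m] give results at distance
    at most 1, within reach of [force_move] because [k] is positive. *)
Let mv m (ab : nat * nat) := maxn (ab.1 - m) (minn (ab.1 + m) ab.2).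

Lemma force_reach p q q' : size q = size p -> size q' = size p ->
  prefix w p -> prefix w q -> prefix w q' ->
  force predT (zip p q) A -> force predT (zip p q') A.
Proof.
move=> sq sq' wp wq wq' fA.
pose path m := [seq mv m ab | ab <- zip q q'].
have path0 : path 0 = q.
  rewrite /path -[RHS](@unzip1_zip _ _ q q') ?sq ?sq' //.
  by apply: eq_map => -[a b]; rewrite /mv /=; lia.
(* Every entry of [q] is at most [sumn q] and every entry of [q'] at most [sumn q'], so no entry has
   to travel further than the sum. *)
have pathN : path (sumn q + sumn q') = q'.
  rewrite /path -[RHS](@unzip2_zip _ _ q q') ?sq ?sq' //.
  apply/eq_in_map => -[a b] /= ab; rewrite /mv /=.
  have qa : a <= sumn q.
    have : a \in q by rewrite -(@unzip1_zip _ _ q q') ?sq ?sq' //;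
      apply: map_f ab.
    by elim: (q) => //= c s IH; rewrite inE => /predU1P[->|/IH]; lia.
  have qb : b <= sumn q'.
    have : b \in q' by rewrite -(@unzip2_zip _ _ q q') ?sq ?sq' //;
      apply: map_f ab.
    by elim: (q') => //= c s IH; rewrite inE => /predU1P[->|/IH]; lia.
  lia.
have spath m : size (path m) = size p by rewrite size_map size_zip sq sq' minnn.
have wpath m : prefix w (path m).
  case/prefixP: wq sq => u qE; case/prefixP: wq' sq' => u' q'E.
  rewrite /path qE q'E !size_cat => sp' sp; rewrite zip_cat // map_cat.
  apply: prefix_catl; apply/prefixP; exists [::]; rewrite cats0.
  rewrite -[RHS](@unzip1_zip _ _ w w) //.
  elim: (w) => //= a s ->; congr (_ :: _); rewrite /mv /=; lia.
rewrite -pathN; elim: (_ + _) => [|m IH]; first by rewrite path0.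
apply: (force_move _ _ _ _ _ _ IH) => //.
rewrite /path; elim: (zip q q') => //= -[a b] s ->.
by rewrite /mv /close_pair /=; lia.
Qed.

(** Given an extension of [zip w w], its first half extends to some [w'] with [A] forced at
    [zip w' w']. By [force_reach] the second copy of [w'] may be replaced by any extension of [w] of
    the same length, in particular by one that prolongs the second half. *)
Lemma force_spread :
  (forall o, prefix w o -> exists w',
    prefix o w' /\ force predT (zip w' w') A) ->
  force predT (zip w w) A.
Proof.
move=> H; apply: force_dense => o _ wo.
have [w' [ow' fA]] := H _ (prefix_unzip1 erefl wo).
have w2 := prefix_unzip2 erefl wo.
case/prefixP: (ow') => v w'E.
pose q := unzip2 o ++ v.
have sq : size q = size w' by rewrite w'E !size_cat !size_map.
exists (zip w' q); split; first exact: all_predT.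
  by rewrite w'E zip_cat ?zip_unzip ?prefix_prefix // !size_map.
have ww' : prefix w w' := prefix_trans (prefix_unzip1 erefl wo) ow'.
apply: (@force_reach w' w' q) => //.
exact: prefix_catl.
Qed.

End Spread.

(** * Generic isomorphism *)

Section Ergodicity.
Variables (symb : countType) (ar : symb -> nat).
Variable M : (nat -> nat) -> forall s : symb, (ar s).-tuple nat -> bool.
Hypothesis bM : forall s (t : (ar s).-tuple nat), borel (fun x => M x t).

Definition str_iso (x y : nat -> nat) : Prop :=
  exists2 g : nat -> nat, bijective g &
    forall s (t : (ar s).-tuple nat), M x t = M y (map_tuple g t).

Definition tuple_rel := seq nat -> seq nat -> (nat -> nat) -> (nat ->
  nat) -> Prop.
Implicit Types (R : tuple_rel) (a b : seq nat) (x y : nat -> nat).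

Definition qf_eq : tuple_rel := fun a b x y =>
  [/\ size a = size b,
      forall i j, i < size a -> j < size a ->
        (nth 0 a i = nth 0 a j <-> nth 0 b i = nth 0 b j) &
      forall s (t : (ar s).-tuple nat), all (fun i => i < size a) t ->
        M x (map_tuple (nth 0 a) t) = M y (map_tuple (nth 0 b) t)].

Definition back_forth_step R : tuple_rel := fun a b x y =>
  [/\ R a b x y,
      forall c, exists d, R (rcons a c) (rcons b d) x y &
      forall d, exists c, R (rcons a c) (rcons b d) x y].

(** Stands in for the countable levels of the Scott analysis; closure under countable intersections
    provides the limit levels without ordinals. *)
Inductive scott_rel : tuple_rel -> Prop :=
| scott_qf : scott_rel qf_eq
| scott_step R : scott_rel R -> scott_rel (back_forth_step R)
| scott_bigcap (R : nat -> tuple_rel) : (forall n, scott_rel (R n)) ->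
    scott_rel (fun a b x y => forall n, R n a b x y).

Lemma scott_rel_qf R a b x y : scott_rel R -> R a b x y -> qf_eq a b x y.
Proof.
by move=> sR; elim: sR => {R} // [R _ IH [/IH]|R _ IH /(_ 0)/IH].
Qed.

Lemma scott_rel_sym R a b x y : scott_rel R -> R a b x y -> R b a y x.
Proof.
move=> sR; elim: sR a b => {R} [a b [sab ab Mab]|R _ IH a b [Rab f g]|R _ IH a
  b H n].
- split=> [//|i j|s t]; rewrite -sab; first by move=> ? ?; rewrite ab.
  by move=> /Mab.
- split; first exact: IH.
  + by move=> d; have [c /IH] := g d; exists c.
  + by move=> c; have [d /IH] := f c; exists d.
- exact: IH.
Qed.

Lemma scott_rel_trans R a b c x y z :
  scott_rel R -> R a b x y -> R b c y z -> R a c x z.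
Proof.
move=> sR.
elim: sR a b c => {R} [a b c [sab ab Mab] [sbc bc Mbc]||R _ IH a b c h h' n].
- split=> [|i j ia ja|s t ta]; first by rewrite sab.
    by rewrite ab // bc -?sab.
  by rewrite Mab // Mbc -?sab.
- move=> R _ IH a b c [Rab f g] [Rbc f' g']; split; first exact: IH Rbc.
  + by move=> i; have [j ij] := f i; have [l jl] := f' j; exists l;
    exact: IH jl.
  + by move=> l; have [j jl] := g' l; have [i ij] := g j; exists i;
    exact: IH jl.
- exact: IH (h n) (h' n).
Qed.

Lemma scott_rel_iso R (g : nat -> nat) a x y : scott_rel R -> bijective g ->
  (forall s (t : (ar s).-tuple nat), M x t = M y (map_tuple g t)) ->
  R a (map g a) x y.
Proof.
move=> sR [g' gK g'K] gM; elim: sR a => {R} [a|R _ IH a|R _ IH a n];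
  last exact: IH.
- split; first by rewrite size_map.
    move=> i j ia ja; rewrite !(nth_map 0) //; split=> [->//|].
    exact: (can_inj gK).
  move=> s t /allP ta; rewrite gM; congr M; apply: val_inj => /=.
  by rewrite -map_comp; apply/eq_in_map => i /ta ia /=; rewrite (nth_map 0).
- split; first exact: IH.
  + by move=> c; exists (g c); have := IH (rcons a c); rewrite map_rcons.
  + by move=> d; exists (g' d); have := IH (rcons a (g' d));
    rewrite map_rcons g'K.
Qed.

Definition on_pairs R a b : (nat -> nat * nat) -> Prop :=
  fun z => R a b (fst \o z) (snd \o z).

Lemma borel_scott_rel R a b : scott_rel R -> borel (on_pairs R a b).
Proof.
move=> sR; elim: sR a b => {R} [a b|R _ IH a b|R _ IH a b]; last first.
  by apply: borel_forall => n; exact: IH.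
  apply: (@borel_ext _ (fun z => on_pairs R a b z /\
      ((forall c, exists d, on_pairs R (rcons a c) (rcons b d) z) /\
       (forall d, exists c, on_pairs R (rcons a c) (rcons b d) z)))).
    by move=> z; split=> [[? []]|[]]; split.
  apply: borel_and; first exact: IH.
  by apply: borel_and; apply: borel_forall => ?; apply: borel_exists => ?;
    exact: IH.
suff bA : borel (fun z : nat -> nat * nat => forall st : {s :
  symb & (ar s).-tuple nat},
    all (fun i => i < size a) (tagged st) ->
      M (fst \o z) (map_tuple (nth 0 a) (tagged st)) =
      M (snd \o z) (map_tuple (nth 0 b) (tagged st))).
  apply: (borel_ext _ (borel_and (borel_const _ (size a = size b /\
    forall i j, i < size a -> j < size a ->
      (nth 0 a i = nth 0 a j <-> nth 0 b i = nth 0 b j))) bA)) => z.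
  split=> [[[sab ab] H]|[sab ab H]].
    by split => // s t; exact: (H (Tagged (fun s => (ar s).-tuple nat) t)).
  by split => // -[s t]; exact: H.
apply: borel_forall => -[s t] /=; apply: borel_imply; first exact: borel_const.
pose N (x : nat -> nat) c := M x (map_tuple (nth 0 c) t).
apply: (@borel_ext _ (fun z => N (fst \o z) a <-> N (snd \o z) b)).
  by move=> z; split=> [h|e]; [exact/is_true_inj/propext|rewrite /N e].
apply: borel_iff.
  by apply: (@borel_pullback _ _ (@fst nat nat) (fun x => N x a)); exact: bM.
by apply: (@borel_pullback _ _ (@snd nat nat) (fun x => N x b)); exact: bM.
Qed.

(** The property carried through the induction on [R]: inside one basic open set, generic invariance
    under moves of size [k] already gives invariance between unrelated generic points. All [k] and
    [w] are quantified because the step for [back_forth_step] doubles [k] and shrinks the open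
    set. *)
Definition loc_const R := forall k w a, 0 < k ->
  force (close_pair k) (zip w w) (on_pairs R a a) ->
  force predT (zip w w) (on_pairs R a a).

Lemma exists_near k : exists t, close_pair k t.
Proof. by exists (0, 0). Qed.

(** Atomic formulas are treated one at a time. By the Baire property the truth value is generically
    constant on densely many basic open sets, so it agrees for pairs inside each of them, and
    [force_spread] extends this to all pairs. *)
Lemma loc_const_qf : loc_const qf_eq.
Proof.
move=> k w a k0 fa.
suff : force predT (zip w w) (fun z => forall st : {s :
  symb & (ar s).-tuple nat},
    all (fun i => i < size a) (tagged st) ->
    M (fst \o z) (map_tuple (nth 0 a) (tagged st)) =
    M (snd \o z) (map_tuple (nth 0 a) (tagged st))).
  apply: force_mono => z _ H; split => // s t.
  exact: (H (Tagged (fun s => (ar s).-tuple nat) t)).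
apply: force_bigcap => -[s t] /=.
have [ta|nta] := boolP (all (fun i => i < size a) t); last exact: force_const.
pose N (x : nat -> nat) := M x (map_tuple (nth 0 a) t).
have bN : borel (fun x => N x) by exact: bM.
pose A (z : nat -> nat * nat) := N (fst \o z) <-> N (snd \o z).
suff : force predT (zip w w) A.
  by apply: force_mono => z _ zA _; exact/is_true_inj/propext.
apply: (@force_spread A (on_pairs qf_eq a a) k) => //.
- apply: borel_iff.
    by apply: (@borel_pullback _ _ (@fst nat nat) (fun x => N x)); exact: bM.
  by apply: (@borel_pullback _ _ (@snd nat nat) (fun x => N x)); exact: bM.
- move=> z [_ _ /(_ s t ta) e]; rewrite /A.
  by rewrite -[N (snd \o (p12 \o z))]/(N (fst \o (p23 \o z))) /N e.
- move=> o wo.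
  have [w' [_ ow' dN]] := borel_decide (ex_intro _ 0 isT) bN (all_predT o).
  exists w'; split => //.
  have e1 : [seq i.1 | i <- zip w' w'] = w' by exact: unzip1_zip.
  have e2 : [seq i.2 | i <- zip w' w'] = w' by exact: unzip2_zip.
  case: dN => fN.
    have g1 : force predT (zip w' w') (fun z :
      nat -> nat * nat => N (fst \o z)).
      apply: (@force_pullback _ _ predT predT _ _ _ _ (fun x => N x));
        rewrite ?e1 //.
      by move=> c _; exists (c, c).
    have g2 : force predT (zip w' w') (fun z :
      nat -> nat * nat => N (snd \o z)).
      apply: (@force_pullback _ _ predT predT _ _ _ _ (fun x => N x));
        rewrite ?e2 //.
      by move=> c _; exists (c, c).
    by apply: force_mono (force_and g1 g2) => z _ [? ?]; split.
  have g1 : force predT (zip w' w') (fun z :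
    nat -> nat * nat => ~ N (fst \o z)).
    apply: (@force_pullback _ _ predT predT _ _ _ _ (fun x => ~ N x));
      rewrite ?e1 //.
    by move=> c _; exists (c, c).
  have g2 : force predT (zip w' w') (fun z :
    nat -> nat * nat => ~ N (snd \o z)).
    apply: (@force_pullback _ _ predT predT _ _ _ _ (fun x => ~ N x));
      rewrite ?e2 //.
    by move=> c _; exists (c, c).
  by apply: force_mono (force_and g1 g2) => z _ [? ?]; split.
Qed.

(** Fix [c]. Close pairs have a partner [d] of [c], and one [d] works on a smaller open set. Two
    points close to a common third one then give [rcons a c] the same [R]-type, so the induction
    hypothesis applies to [rcons a c] with [k + k], and [force_spread] carries the result back to
    [w]. *)
Lemma loc_const_step R : scott_rel R -> loc_const R ->
  loc_const (back_forth_step R).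
Proof.
move=> sR lR k w a k0 fa.
have forth c : force predT (zip w w)
    (fun z => exists d, on_pairs R (rcons a c) (rcons a d) z).
  apply: (@force_spread _ (on_pairs (back_forth_step R) a a) k) => //.
  - by apply: borel_exists => d; exact: borel_scott_rel.
  - move=> z [_ f _] [d xy]; have [e ye] := f d.
    by exists e; exact: scott_rel_trans xy ye.
  move=> o wo.
  have fo : force (close_pair k) (zip o o)
      (fun z => exists d, on_pairs R (rcons a c) (rcons a d) z).
    have := force_ext (prefix_zip wo wo erefl) fa.
    by apply: force_mono => z _ [_ + _]; apply.
  (* The category argument: a single [d] serves all generic close pairs that extend [t]. *)
  have [d [t [St ot ft]]] := force_exists (exists_near k)
    (fun d => borel_scott_rel (rcons a c) (rcons a d) sR) (all_zip_diag k o) fo.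
  pose q := unzip1 t; pose p := unzip2 t.
  have sqp : size p = size q by rewrite !size_map.
  have tE : t = zip q p by rewrite zip_unzip.
  exists q; split; first exact: prefix_unzip1 erefl ot.
  (* The first member of the triple is the common neighbour of the other two; both pairs extend [t],
     so both compare [rcons a c] with the same [rcons a d]. *)
  pose S3 : pred (nat * nat * nat) :=
    [pred t | close_pair k (t.1.2, t.1.1) & close_pair k (t.2, t.1.1)].
  pose tau := zip (zip p q) q.
  have Stau : all S3 tau.
    move: St; rewrite tE /tau; elim: (p) (q) => [|i p' IH] [|j q'] //=.
    by move=> /andP[ij /IH ->]; rewrite !andbT /S3 /= ij.
  have fu : force S3 tau (fun z => on_pairs R (rcons a c) (rcons a d)
      ((fun t => (t.1.2, t.1.1)) \o z)).
    apply: (@force_pullback _ _ S3 (close_pair k)).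
    - by move=> u /andP[].
    - by move=> [i j] ij; exists (j, i, i) => //; rewrite /S3 /= ij.
    - suff -> : [seq (t.1.2, t.1.1) | t <- tau] = t by [].
      rewrite tE /tau; elim: (p) (q) sqp => [|i p' IH] [|j q'] //= [] /IH -> //.
  have fv : force S3 tau (fun z => on_pairs R (rcons a c) (rcons a d)
      ((fun t => (t.2, t.1.1)) \o z)).
    apply: (@force_pullback _ _ S3 (close_pair k)).
    - by move=> u /andP[].
    - by move=> [i j] ij; exists (j, i, i) => //; rewrite /S3 /= ij.
    - suff -> : [seq (t.2, t.1.1) | t <- tau] = t by [].
      rewrite tE /tau; elim: (p) (q) sqp => [|i p' IH] [|j q'] //= [] /IH -> //.
  have fuv : force S3 tau (fun z =>
    on_pairs R (rcons a c) (rcons a c) (p23 \o z)).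
    apply: force_mono (force_and fu fv) => z _ [zu zv].
    exact: scott_rel_trans sR zu (scott_rel_sym sR zv).
  have fqq : force (close_pair (k + k)) (zip q q) (on_pairs R (rcons a c)
    (rcons a c)).
    rewrite -(@map_p23 p q q) //.
    apply: force_mono; last apply:
      (@force_push _ _ S3 (close_pair (k + k)) p23 _ _ _ _ Stau fuv).
    - by move=> z' _ [z [_ h /funext <-]].
    - by move=> [[i j] l]; rewrite /S3 /close_pair /p23 /=; lia.
    - move=> [i j]; rewrite /close_pair /= => ij.
      (* Numbers at distance at most [k + k] have their rounded midpoint within [k] of both. *)
      exists (minn i j + (maxn i j - minn i j) %/ 2, i, j) => //.
      by rewrite /S3 /close_pair /=; lia.
  have := lR _ _ _ (ltn_addr k k0) fqq.
  by apply: force_mono => z _ h; exists c.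
have step0 : force predT (zip w w) (on_pairs R a a).
  by apply: lR k0 _; apply: force_mono fa => z _ [].
have f1 := force_bigcap forth.
(* The back clause is the forth clause with the two sequences exchanged, by symmetry of [R]. *)
have f2 : force predT (zip w w)
    (fun z => forall d, exists c, on_pairs R (rcons a c) (rcons a d) z).
  pose sw (t : nat * nat) := (t.2, t.1).
  have swK i : exists2 t, predT t & sw t = i by exists (sw i) => //; case: i.
  have sww : map sw (zip w w) = zip w w by elim: (w) => //= i s ->.
  rewrite -sww in f1.
  have := @force_pullback _ _ predT predT sw (fun _ _ => isT) (fun i _ =>
    swK i) _ _ f1.
  by apply: force_mono => z _ H d; have [c zc] := H d; exists c;
    exact: scott_rel_sym sR zc.
by apply: force_mono (force_and step0 (force_and f1 f2)) => z _ [? []].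
Qed.

Lemma loc_const_scott R : scott_rel R -> loc_const R.
Proof.
elim=> {R} [|R sR IH|R _ IH].
- exact: loc_const_qf.
- exact: loc_const_step.
- move=> k w a k0 fa; apply: force_bigcap => n; apply: IH (k0) _.
  by apply: force_mono fa => z _; apply.
Qed.

(* Since the topology has a countable base, a family of Borel sets closed under
   countable intersections has a least element modulo meager sets; this replaces
   the transfinite Scott analysis. *)
Lemma scott_rel_stable : exists2 R, scott_rel R &
  forall a b, force predT [::]
    (fun z => on_pairs R a b z -> on_pairs (back_forth_step R) a b z).
Proof.
pose idx := (seq (nat * nat) * seq nat * seq nat)%type.
(* For each basic open set and pair of tuples, a relation is chosen that fails there generically,
   whenever some relation does. *)
have /boolp.choice[Ri Rip] : forall i : idx, exists R, scott_rel R /\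
    ((exists2 R', scott_rel R' &
       force predT i.1.1 (fun z => ~ on_pairs R' i.1.2 i.2 z)) ->
     force predT i.1.1 (fun z => ~ on_pairs R i.1.2 i.2 z)).
  move=> i; case: (pselect (exists2 R', scott_rel R' &
       force predT i.1.1 (fun z => ~ on_pairs R' i.1.2 i.2 z))) =>
         [[R sR fR]|nR].
    by exists R.
  by exists qf_eq; split => //; exact: scott_qf.
pose Rn n := if unpickle n is Some i then Ri i else qf_eq.
have sRn n : scott_rel (Rn n).
  rewrite /Rn; case: (unpickle n) => [i|]; last exact: scott_qf.
  by case: (Rip i).
pose R : tuple_rel := fun a b x y => forall n, Rn n a b x y.
have sR : scott_rel R by exact: scott_bigcap.
exists R => // a b; apply: force_dense => t _ _.
have T0 : exists t : nat * nat, predT t by exists (0, 0).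
have [u [_ tu [fu|fu]]] :=
  borel_decide T0 (borel_scott_rel a b (scott_step sR)) (all_predT t).
  exists u; split; [exact: all_predT|exact: tu|].
  by apply: force_mono fu => z _ ? _.
(* Here the step of [R] fails generically, so the relation chosen for [(u, a, b)] fails too; [R] is
   contained in it, and the implication holds vacuously. *)
exists u; split; [exact: all_predT|exact: tu|].
have [_ Riu] := Rip (u, a, b).
have := Riu (ex_intro2 _ _ (back_forth_step R) (scott_step sR) fu).
apply: force_mono => z _ nRi Rz; case: nRi.
by have := Rz (pickle (u, a, b)); rewrite /Rn pickleK.
Qed.

(** A branch through the pairs of tuples in [P] that meets every [c] on the left and every [d] on
    the right enumerates the graph of an isomorphism. *)
Lemma back_forth_iso (P : seq nat -> seq nat -> Prop) x y :
  (forall a b, P a b -> qf_eq a b x y) ->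
  (forall a b c, P a b -> exists d, P (rcons a c) (rcons b d)) ->
  (forall a b d, P a b -> exists c, P (rcons a c) (rcons b d)) ->
  P [::] [::] -> str_iso x y.
Proof.
move=> Pqf forth back P0.
pose G (t : seq (nat * nat)) := P (unzip1 t) (unzip2 t).
pose D (i : nat + nat) (t : seq (nat * nat)) :=
  match i with inl c => c \in unzip1 t | inr d => d \in unzip2 t end.
have Gr t : G t -> exists ab, G (rcons t ab).
  move=> Gt; have [d Pd] := forth _ _ 0 Gt; exists (0, d).
  by rewrite /G /unzip1 /unzip2 !map_rcons.
have [|z [_ zG zD]] := @generic_branch _ _ G D [::] P0 Gr _.
  move=> [c|d] t _ Gt.
    have [d Pd] := forth _ _ c Gt; exists (rcons t (c, d)).
    split; [by rewrite /G /unzip1 /unzip2 !map_rcons|exact: prefix_rcons|].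
    by rewrite /D /unzip1 map_rcons mem_rcons inE eqxx.
  have [c Pd] := back _ _ d Gt; exists (rcons t (c, d)).
  split; [by rewrite /G /unzip1 /unzip2 !map_rcons|exact: prefix_rcons|].
  by rewrite /D /unzip2 map_rcons mem_rcons inE eqxx.
have nth1 m i : i < m -> nth 0 (unzip1 (mkseq z m)) i = (z i).1.
  by move=> im; rewrite (nth_map (0, 0)) ?size_mkseq // nth_mkseq.
have nth2 m i : i < m -> nth 0 (unzip2 (mkseq z m)) i = (z i).2.
  by move=> im; rewrite (nth_map (0, 0)) ?size_mkseq // nth_mkseq.
have zz i j : (z i).1 = (z j).1 <-> (z i).2 = (z j).2.
  have [m [mij /Pqf[_ + _]]] := zG (maxn i j).+1.
  move/(_ i j); rewrite size_map size_mkseq !nth1 ?nth2; lia.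
have /boolp.choice[N1 N1P] c : exists n, (z n).1 = c.
  by have [n /mapP[_ /mapP[i _ ->] ->]] := zD (inl c); exists i.
have /boolp.choice[N2 N2P] d : exists n, (z n).2 = d.
  by have [n /mapP[_ /mapP[i _ ->] ->]] := zD (inr d); exists i.
pose g c := (z (N1 c)).2; pose g' d := (z (N2 d)).1.
have gz n : g (z n).1 = (z n).2 by apply/zz; rewrite N1P.
have gz' n : g' (z n).2 = (z n).1 by apply/zz; rewrite N2P.
exists g.
  by exists g' => [c|d]; [rewrite -(N1P c) gz gz'|rewrite -(N2P d) gz' gz].
move=> s t; pose t' := map_tuple N1 t.
(* The sum bounds every index in [t'], so a prefix of length [m] contains all entries of [t]
   together with their images. *)
have [m [mt /Pqf[_ _ /(_ s t')]]] := zG (\sum_(i <- t') i).+1.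
rewrite size_map size_mkseq => h.
have t'm i : i \in (t' : seq nat) -> i < m.
  move=> it; apply: leq_trans mt; rewrite ltnS.
  by rewrite (big_rem i) //= leq_addr.
have := h (introT allP t'm); congr (_ = _); congr M; apply: val_inj => /=.
  rewrite -map_comp -[RHS]map_id; apply/eq_in_map => c ct /=.
  by rewrite nth1 ?N1P // t'm // map_f.
rewrite -map_comp; apply/eq_in_map => c ct /=.
by rewrite nth2 // t'm // map_f.
Qed.

(** Sequences at distance at most 1 give isomorphic structures, so the empty tuple has the same
    [R]-type in both; [loc_const_scott] extends this to generic pairs. For the stable [R],
    generically [R] is itself a back-and-forth system. *)
Theorem generic_iso :
  (forall x y, (forall n, close_pair 1 (x n, y n)) -> str_iso x y) ->
  force predT [::] (fun z => str_iso (fst \o z) (snd \o z)).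
Proof.
move=> near_iso; have [R sR Rst] := scott_rel_stable.
have fR : force predT [::] (on_pairs R [::] [::]).
  apply: (loc_const_scott sR (k := 1) (w := [::]) (a := [::])) => //.
  apply: force_const => z nz.
  have [|g bg gM] := near_iso (fst \o z) (snd \o z).
    by move=> n; rewrite /= -surjective_pairing.
  exact: (scott_rel_iso [::] sR bg gM).
have fst : force predT [::] (fun z => forall ab, on_pairs R ab.1 ab.2 z ->
    on_pairs (back_forth_step R) ab.1 ab.2 z).
  by apply: force_bigcap => -[a b]; exact: Rst.
apply: force_mono (force_and fR fst) => z _ [R0 H].
apply: (@back_forth_iso (fun a b => on_pairs R a b z)) => //.
- by move=> a b /scott_rel_qf; apply.
- by move=> a b c /(H (a, b))[_ + _]; apply.
- by move=> a b d /(H (a, b))[_ _]; apply.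
Qed.

End Ergodicity.

(** * The Hilbert cube *)

Local Open Scope classical_set_scope.
Local Open Scope ring_scope.

Section HilbertCube.
Variable R : realType.
Local Notation Q := (hilbert_cube R).
Implicit Types (z w : Q) (K : set Q).

Definition cube_coord (n : nat) z : R := set_val z n.

Lemma cube_coord_ge0 n z : 0 <= cube_coord n z.
Proof. by have /andP[] := set_valP z n. Qed.

Lemma cube_coord_le1 n z : cube_coord n z <= 1.
Proof. by have /andP[] := set_valP z n. Qed.

Lemma coord_inj z w : cube_coord^~ z =1 cube_coord^~ w -> z = w.
Proof. by move=> zw; apply: val_inj; apply/funext. Qed.

Lemma cube_point_subproof (v : nat -> R) :
  (fun n => Num.max 0 (Num.min 1 (v n))) \in
  [set x : prod_topology (fun _ : nat => R) | forall n, 0 <= x n <= 1].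
Proof.
apply/mem_set => n /=; rewrite le_max lexx /= ge_max ler01 /=.
by rewrite ge_min lexx.
Qed.

Definition cube_point (v : nat -> R) : Q := SigSub (cube_point_subproof v).

Lemma coord_cube_point v n :
  cube_coord n (cube_point v) = Num.max 0 (Num.min 1 (v n)).
Proof. by []. Qed.

Lemma coord_cube_point_in v n :
  0 <= v n <= 1 -> cube_coord n (cube_point v) = v n.
Proof.
by move=> /andP[v0 v1]; rewrite coord_cube_point (min_idPr v1) (max_idPr v0).
Qed.

Lemma continuous_coord n : continuous (cube_coord n).
Proof.
move=> z; apply/(@cvgrPdist_lt _ _ _ _ (nbhs_filter z)) => e e0.
have p2 : 0 < 2 ^+ n :> R by rewrite exprn_gt0.
have : nbhs z (ball z (e / 2 ^+ n)) by apply: nbhsx_ballx; rewrite divr_gt0.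
apply: filterS => w zw.
have := le_lt_trans (hilbert_dist_ub z w n) zw.
by rewrite ltr_pM2r // invr_gt0.
Qed.

Lemma nbhs_cube_dist z U : nbhs z U <->
  exists2 e, 0 < e & forall w, hilbert_dist z w < e -> U w.
Proof.
split=> [/nbhs_ballP[e /= e0 eU]|[e e0 eU]]; first by exists e.
by apply/nbhs_ballP; exists e.
Qed.

(** By Tychonoff the image filter clusters in the product of unit intervals, and the cluster point
    lies in the cube. *)
Lemma compact_cube : compact [set: Q].
Proof.
have cP : compact [set x : prod_topology (fun _ : nat => R) |
    forall n, `[0, 1]%classic (x n)].
  exact: (@tychonoff nat (fun=> R) (fun=> `[0, 1]%classic)
    (fun=> @segment_compact R 0 1)).
move=> F PF _; pose G := (set_val : Q -> prod_topology (fun _ : nat => R)) @ F.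
have PG : ProperFilter G by exact: fmap_proper_filter.
have [|x [x01 xG]] := cP G PG.
  have : F ((set_val : Q -> prod_topology (fun _ : nat => R)) @^-1`
      [set x | forall n, `[0, 1]%classic (x n)]) by
    apply: filterS filterT => z _ n; rewrite /= in_itv; apply/andP; split;
      [exact: (cube_coord_ge0 n z)|exact: (cube_coord_le1 n z)].
  exact: id.
have xP : x \in [set x : prod_topology (fun _ :
  nat => R) | forall n, 0 <= x n <= 1].
  by apply/mem_set => n; have := x01 n; rewrite /= in_itv.
exists (SigSub xP); split => // A B FA [_ [[V oV <-] Vx VB]].
have GA : G [set (set_val : Q -> prod_topology (fun _ : nat => R)) z | z in A].
  have : F ((set_val : Q -> prod_topology (fun _ : nat => R)) @^-1`
      [set set_val z | z in A]) by apply: filterS FA => z Az; exists z.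
  exact: id.
have [y [[z Az <-] Vz]] :
    [set (set_val : Q -> prod_topology (fun _ :
      nat => R)) z | z in A] `&` V !=set0.
  by apply: xG => //; exact: open_nbhs_nbhs.
by exists z; split => //; exact: VB.
Qed.

Lemma nbhs_sub_dist K (z : set_type K) U : nbhs z U <->
  exists2 e, 0 < e &
    forall w : set_type K, hilbert_dist (set_val z) (set_val w) < e -> U w.
Proof.
split=> [[_ [[V oV <-] Vz VU]]|[e e0 eU]].
  have /nbhs_cube_dist[e e0 eV] : nbhs (set_val z) V by exact: open_nbhs_nbhs.
  by exists e => // w zw; apply: VU; exact: eV.
have : nbhs z (set_val @^-1` (ball (set_val z) e)).
  by apply: initial_continuous; exact: nbhsx_ballx.
by apply: filterS => w zw; exact: eU.
Qed.

Definition near4 (e : R) z w :=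
  forall n, (n < 4)%N -> `|cube_coord n z - cube_coord n w| < e.

Lemma nbhs_sub_near4 K (z : set_type K) U :
  (forall w n, K w -> (4 <= n)%N -> cube_coord n w = 0) ->
  nbhs z U <->
  exists2 e, 0 < e & forall w :
    set_type K, near4 e (set_val z) (set_val w) -> U w.
Proof.
move=> K0; split=> [/nbhs_sub_dist|]; case=> e e0 eU.
  have e2 : 0 < e / 2 by rewrite divr_gt0.
  exists (e / 2) => // w zw; apply: eU.
  apply: (@le_lt_trans _ _ (e / 2));
    last by rewrite ltr_pdivrMr // ltr_pMr // ltr1n.
  apply: hilbert_dist_le => n.
  rewrite ler_pdivrMr ?exprn_gt0 //.
  apply: (@le_trans _ _ (e / 2)); last first.
    by rewrite ler_peMr ?(ltW e2) // exprn_ege1 // ler1n.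
  have [n4|n4] := ltnP n 4; first exact/ltW/zw.
  rewrite -!/(cube_coord _ _) !K0 //; try exact: set_valP.
  by rewrite subrr normr0 ltW.
(* The metric divides coordinate [n] by [2 ^+ n], which is at most 16 for the four coordinates
   concerned. *)
apply/nbhs_sub_dist; exists (e / 16); first by rewrite divr_gt0.
move=> w zw; apply: eU => n n4.
have := le_lt_trans (hilbert_dist_ub (set_val z) (set_val w) n) zw.
have p2 : 0 < 2 ^+ n :> R by rewrite exprn_gt0.
rewrite ltr_pdivrMr // -!/(cube_coord _ _) => /lt_le_trans; apply.
rewrite -[leRHS]mulr1 -mulrA ler_pM2l // mulrC ler_pdivrMr // mul1r.
have -> : (16 = 2 ^+ 4 :> R) by rewrite -natrX.
by rewrite ler_eXn2l ?ltr1n // ltnW.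
Qed.

End HilbertCube.

(** * The compacta [fan x] *)

Section Fan.
Variable R : realType.
Local Notation Q := (hilbert_cube R).
Implicit Types (z w : Q) (x y : nat -> nat).

Definition hgt (n : nat) : R := (2 ^+ n)^-1.

Lemma hgt_gt0 n : 0 < hgt n.
Proof. by rewrite invr_gt0 exprn_gt0. Qed.

Lemma hgtS n : hgt n = 2 * hgt n.+1.
Proof. by rewrite /hgt exprS invfM mulrA mulfV ?mul1r // pnatr_eq0. Qed.

Lemma hgt0 : hgt 0 = 1.
Proof. by rewrite /hgt expr0 invr1. Qed.

Lemma hgt_lt m n : (m < n)%N -> hgt n < hgt m.
Proof. by move=> mn; rewrite ltf_pV2 ?posrE ?exprn_gt0 // ltr_eXn2l ?ltr1n. Qed.

Lemma hgt_le m n : (m <= n)%N -> hgt n <= hgt m.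
Proof. by rewrite leq_eqVlt => /predU1P[->//|/hgt_lt/ltW]. Qed.

Lemma hgt_le1 n : hgt n <= 1.
Proof. by rewrite -hgt0; exact: hgt_le. Qed.

Lemma hgt_inj : injective hgt.
Proof.
by move=> m n e; case: (ltngtP m n) => // /hgt_lt; rewrite e ltxx.
Qed.

Lemma hgt_small (e : R) : 0 < e -> exists N, hgt N < e.
Proof.
move=> e0; exists (Num.bound e^-1); rewrite /hgt invf_plt ?posrE ?exprn_gt0 //.
apply: lt_le_trans (archi_boundP _) _; first by rewrite invr_ge0 ltW.
by rewrite -natrX ler_nat ltnW // ltn_expl.
Qed.

(** A closed condition, stated as avoiding the gaps between consecutive [hgt j]; in [[0,1]] it
    leaves 0 and the powers [hgt n]. *)
Definition dyadic (t : R) := forall j, t <= hgt j.+1 \/ hgt j <= t.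

Lemma dyadic_hgt n : dyadic (hgt n).
Proof. by move=> j; case: (leqP n j) => nj; [right|left]; exact: hgt_le. Qed.

Lemma dyadic0 : dyadic 0.
Proof. by move=> j; left; exact/ltW/hgt_gt0. Qed.

Lemma dyadic_near t n : t <= 1 -> dyadic t -> `|t - hgt n| < hgt n.+1 ->
  t = hgt n.
Proof.
move=> t1 dt; rewrite ltr_norml => /andP[h1 h2]; have hn := hgtS n.
have tn : hgt n <= t by case: (dt n) => // ?; lra.
apply/eqP; rewrite eq_le tn andbT.
(* Above [hgt n.+1] comes the gap up to [hgt n]; above [hgt 0 = 1] the bound [t <= 1] takes over. *)
case: n h1 h2 hn tn => [|n] h1 h2 hn tn; first by rewrite hgt0.
by case: (dt n) => // ?; have := hgtS n; lra.
Qed.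

Lemma dyadicP t : 0 < t <= 1 -> dyadic t -> exists n, t = hgt n.
Proof.
move=> /andP[t0 t1] dt; have [N Nt] := hgt_small t0.
have ex : exists n, hgt n <= t by exists N; exact: ltW.
case: (ex_minnP ex) => -[|n] nt nmin; first by exists 0%N; apply/le_anti;
  rewrite nt hgt0 t1.
exists n.+1; apply/le_anti; rewrite nt andbT.
by case: (dt n) => // h; have := nmin n h; rewrite ltnn.
Qed.

(** Truncation at [2 ^ n] makes the fan available for every sequence of naturals, so that the
    category argument runs on the full sequence space, and it does not increase distances. *)
Definition pos x n : R := (minn (x n) (2 ^ n))%:R * hgt n.

Lemma pos_ge0 x n : 0 <= pos x n.
Proof. by rewrite mulr_ge0 // ltW // hgt_gt0. Qed.

Lemma pos_le1 x n : pos x n <= 1.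
Proof.
rewrite /pos /hgt ler_pdivrMr ?exprn_gt0 // mul1r -natrX ler_nat.
exact: geq_minr.
Qed.

Lemma pos0 x n : x n = 0%N -> pos x n = 0.
Proof. by rewrite /pos => ->; rewrite min0n mul0r. Qed.

Lemma pos1 x n : x n = (2 ^ n)%N -> pos x n = 1.
Proof. by rewrite /pos => ->;
  rewrite minnn natrX mulfV // expf_neq0 // pnatr_eq0. Qed.

Lemma pos_near x y n : (x n <= y n + 1)%N -> (y n <= x n + 1)%N ->
  `|pos x n - pos y n| <= hgt n.
Proof.
move=> xy yx; rewrite /pos -mulrBl normrM (ger0_norm (ltW (hgt_gt0 n))).
rewrite -[leRHS]mul1r ler_pM2r ?hgt_gt0 // ler_norml.
set a := minn _ _; set b := minn _ _.
have ab : (a <= b + 1)%N by rewrite /a /b; lia.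
have ba : (b <= a + 1)%N by rewrite /a /b; lia.
by move: ab ba; rewrite -!(ler_nat R) !natrD; lra.
Qed.

Definition mark_heights n : set R :=
  [set t | exists2 i, (i < n)%N & t = hgt (n + i)].

(* [fan x] is the union of the arc [0,1] x {(0,0,0)}, of the arcs
   {(pos x n, 2^-n)} x [0,2^-n] x {0}, and of isolated points accumulating at
   exactly [n] points of the [n]-th small arc; the conditions are phrased so
   that they are visibly closed. *)
Definition fan x : set Q := [set z | [/\
  forall n, (4 <= n)%N -> cube_coord n z = 0,
  cube_coord 2 z <= cube_coord 1 z /\ cube_coord 3 z <= cube_coord 1 z,
  dyadic (cube_coord 1 z), dyadic (cube_coord 3 z) &
  forall n, [\/ cube_coord 1 z <= hgt n.+1, 2 * hgt n <= cube_coord 1 z |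
    cube_coord 0 z = pos x n /\
      (cube_coord 3 z = 0 \/ mark_heights n (cube_coord 2 z))]]].

Lemma closed_mark_heights n : closed (mark_heights n).
Proof.
suff H m : closed [set t | exists2 i, (i < m)%N & t = hgt (n + i)] by exact: H.
elim: m => [|m IH].
  by rewrite (_ : mkset _ = set0); [exact: closed0|apply/seteqP;
    split => t // []].
rewrite (_ : mkset _ = [set t | exists2 i, (i < m)%N & t = hgt (n + i)] `|`
    [set hgt (n + m)]); first exact: closedU IH (@closed_eq _ _).
apply/seteqP; split => t /= => [[i + ->]|[[i im ->]|->]].
- by rewrite ltnS leq_eqVlt => /predU1P[->|im]; [right|left; exists i].
- by exists i => //; exact: leqW.
- by exists m.
Qed.

Lemma closed_coord n (D : set R) :
  closed D -> closed [set z | D (cube_coord n z)].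
Proof.
exact: (proj1 (continuous_closedP _) (@continuous_coord R n)).
Qed.

Lemma closed_coord_le m n : closed [set z :
  Q | cube_coord m z <= cube_coord n z].
Proof.
rewrite (_ : mkset _ = (fun z =>
  cube_coord n z - cube_coord m z) @^-1` [set t | 0 <= t]); last first.
  by apply/seteqP; split => z /=; rewrite subr_ge0.
apply: (proj1 (continuous_closedP _)); last exact: closed_ge.
move=> z; exact: (cvgB (@continuous_coord R n z) (@continuous_coord R m z)).
Qed.

Lemma closed_dyadic : closed dyadic.
Proof.
rewrite (_ : dyadic = \bigcap_j ([set t | t <= hgt j.+1] `|` [set t | hgt j <=
  t])).
  by apply: closed_bigI => j _; apply: closedU;
    [exact: closed_le|exact: closed_ge].
by apply/seteqP; split => t H j; [move=> _; exact: H|exact: (H j I)].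
Qed.

Lemma closed_fan x : closed (fan x).
Proof.
rewrite (_ : fan x =
  (\bigcap_(n in [set n | (4 <= n)%N]) [set z | [set 0] (cube_coord n z)]) `&`
  ([set z | cube_coord 2 z <= cube_coord 1 z] `&` [set z | cube_coord 3 z <=
    cube_coord 1 z]) `&`
  ([set z | dyadic (cube_coord 1 z)] `&` [set z | dyadic (cube_coord 3 z)]) `&`
  \bigcap_n ([set z | [set t | t <= hgt n.+1] (cube_coord 1 z)] `|`
    ([set z | [set t | 2 * hgt n <= t] (cube_coord 1 z)] `|`
     ([set z | [set pos x n] (cube_coord 0 z)] `&`
      ([set z | [set 0] (cube_coord 3 z)] `|` [set z | mark_heights n
        (cube_coord 2 z)]))))).
  repeat apply: closedI; try exact: closed_coord_le;
    try exact: closed_coord closed_dyadic.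
    apply: closed_bigI => n _; apply: closed_coord; exact: closed_eq.
  apply: closed_bigI => n _; apply: closedU.
    by apply: closed_coord; exact: closed_le.
  apply: closedU; first by apply: closed_coord; exact: closed_ge.
  apply: closedI; first by apply: closed_coord; exact: closed_eq.
  apply: closedU; first by apply: closed_coord; exact: closed_eq.
  by apply: closed_coord; exact: closed_mark_heights.
apply/seteqP; split => z.
  move=> [h1 [h2 h3] h4 h5 h6]; split; first by split; [split => // n|].
  by move=> n _; case: (h6 n) => [h|h|[h h']]; [left|right; left|right; right].
move=> [[[h1 [h2 h3]] [h4 h5]] h6]; split => // n.
by case: (h6 n I) => [h|[h|[h h']]]; [apply: Or31|apply: Or32|apply: Or33].
Qed.

Lemma compact_fan x : compact (fan x).
Proof.
exact: subclosed_compact (@closed_fan x) (@compact_cube R) (@subsetT _ _).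
Qed.

Definition pt (a b c d : R) : Q := cube_point (fun n => nth 0 [:: a; b; c;
  d] n).

Lemma coord_pt a b c d : 0 <= a <= 1 -> 0 <= b <= 1 -> 0 <= c <= 1 ->
  0 <= d <= 1 ->
  [/\ cube_coord 0 (pt a b c d) = a, cube_coord 1 (pt a b c d) = b,
      cube_coord 2 (pt a b c d) = c, cube_coord 3 (pt a b c d) = d &
      forall n, (4 <= n)%N -> cube_coord n (pt a b c d) = 0].
Proof.
move=> ha hb hc hd; rewrite !coord_cube_point_in //; split => //.
by move=> [|[|[|[|n]]]] // _;
  rewrite coord_cube_point_in /= ?nth_nil // lexx ler01.
Qed.

Lemma hgt01 n : 0 <= hgt n <= 1.
Proof. by rewrite hgt_le1 ltW // hgt_gt0. Qed.

Lemma pos01 x n : 0 <= pos x n <= 1.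
Proof. by rewrite pos_ge0 pos_le1. Qed.

Lemma zero01 : 0 <= (0 : R) <= 1.
Proof. by rewrite lexx ler01. Qed.

Lemma fan_base x a : 0 <= a <= 1 -> fan x (pt a 0 0 0).
Proof.
move=> a01; have [h0 h1 h2 h3 h4] := coord_pt a01 zero01 zero01 zero01.
split; rewrite ?h1 ?h2 ?h3 //; try exact: dyadic0.
by move=> n; apply: Or31; exact/ltW/hgt_gt0.
Qed.

Lemma fan_piece x n c d : 0 <= c <= hgt n -> 0 <= d <= hgt n -> dyadic d ->
  d = 0 \/ mark_heights n c -> fan x (pt (pos x n) (hgt n) c d).
Proof.
move=> c01 d01 dd H.
have le1 t : 0 <= t <= hgt n -> 0 <= t <= 1.
  by move=> /andP[-> h] /=; exact: le_trans h (hgt_le1 n).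
have [h0 h1 h2 h3 h4] := coord_pt (pos01 x n) (hgt01 n) (le1 _ c01) (le1 _ d01).
split; rewrite ?h1 ?h2 ?h3 //; try exact: dyadic_hgt.
  by case/andP: c01 => _ ->; case/andP: d01.
move=> m; case: (ltngtP m n) => [mn|nm|->].
- by apply: Or31; exact: hgt_le.
- by apply: Or32; case: m nm => // m nm; rewrite -hgtS; exact: hgt_le.
- by apply: Or33; split.
Qed.

Lemma fan_neq0 x : fan x !=set0.
Proof. by exists (pt 0 0 0 0); apply: fan_base; exact: zero01. Qed.

Lemma fan_tail x z n : fan x z -> (4 <= n)%N -> cube_coord n z = 0.
Proof. by case=> + _ _ _ _; apply. Qed.

Lemma fan_coord_inj x z w : fan x z -> fan x w ->
  cube_coord 0 z = cube_coord 0 w -> cube_coord 1 z = cube_coord 1 w ->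
    cube_coord 2 z = cube_coord 2 w ->
  cube_coord 3 z = cube_coord 3 w -> z = w.
Proof.
move=> fz fw e0 e1 e2 e3; apply: coord_inj => -[|[|[|[|n]]]] //.
by rewrite (fan_tail fz) // (fan_tail fw).
Qed.

(** At level 0 the inequalities of [fan] squeeze coordinates 2 and 3 to 0. A positive level is some
    [hgt n], and at this [n] only the last alternative of [fan] is possible. *)
Lemma fan_cases x z : fan x z ->
  (cube_coord 1 z = 0 /\ cube_coord 2 z = 0 /\ cube_coord 3 z = 0) \/
  exists n, [/\ cube_coord 1 z = hgt n, cube_coord 0 z = pos x n,
    cube_coord 2 z <= hgt n, cube_coord 3 z <= hgt n &
    cube_coord 3 z = 0 \/ mark_heights n (cube_coord 2 z)].
Proof.
move=> [_ [h2 h3] d1 d3 H].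
have := cube_coord_ge0 1 z; rewrite le_eqVlt => /predU1P[e|z0].
  left; rewrite -e in h2 h3 *; split => //; split; apply/le_anti.
    by rewrite h2 cube_coord_ge0.
  by rewrite h3 cube_coord_ge0.
right; have [|n e] := @dyadicP (cube_coord 1 z) _ d1;
  first by rewrite z0 cube_coord_le1.
exists n; rewrite e in h2 h3; have h := hgt_gt0 n; have hn := hgtS n.
by case: (H n) => [|| [? ?]]; rewrite e //; lra.
Qed.

Lemma fan_piece_cases x z n : fan x z -> cube_coord 1 z = hgt n ->
  [/\ cube_coord 0 z = pos x n, cube_coord 2 z <= hgt n,
    cube_coord 3 z <= hgt n &
    cube_coord 3 z = 0 \/ mark_heights n (cube_coord 2 z)].
Proof.
move=> fz e; case: (fan_cases fz) => [[e0 _]|[m [em]]].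
  by have := hgt_gt0 n; rewrite -e e0 ltxx.
by move: em; rewrite e => /hgt_inj <-.
Qed.

Lemma fan_level x z n : fan x z -> `|cube_coord 1 z - hgt n| < hgt n.+1 ->
  cube_coord 1 z = hgt n.
Proof. by move=> [_ _ d1 _ _]; apply: dyadic_near d1;
  exact: cube_coord_le1. Qed.

Definition fan_compactum x : hyperspace Q :=
  Hyperspace (@compact_fan x) (fan_neq0 x).

(** The pieces of index below [N] are common to both fans. A point of a later piece has coordinates
    1, 2 and 3 at most [hgt N], so it is close to its projection on the base arc. *)
Lemma fan_thickening x y N e :
  (forall n, (n < N)%N -> x n = y n) -> hgt N < e ->
  fan x `<=` thickening (fan y) e.
Proof.
move=> xy Ne z fz.
have e0 : 0 < e by exact: lt_trans (hgt_gt0 N) Ne.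
have [[e1 _]|[n [e1 e0' h2 h3 h]]] := fan_cases fz.
  exists z; last by rewrite mdistxx.
  case: fz => *; split => // n; apply: Or31; rewrite e1; exact/ltW/hgt_gt0.
have [nN|Nn] := ltnP n N.
  exists z; last by rewrite mdistxx.
  case: (fz) => h4 ? ? ? H; split => // m; case: (H m);
    [exact: Or31|exact: Or32|].
  move=> [e0'' h']; have [mn|mn] := eqVneq m n.
    by apply: Or33; split => //; rewrite e0'' /pos mn xy.
  case: (ltngtP m n) mn => // [mn|nm] _.
    by apply: Or31; rewrite e1; exact: hgt_le.
  by apply: Or32; rewrite e1; case: m nm {e0'' h'} => // m nm; rewrite -hgtS;
    exact: hgt_le.
have a01 : 0 <= cube_coord 0 z <= 1 by rewrite cube_coord_ge0 cube_coord_le1.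
exists (pt (cube_coord 0 z) 0 0 0); first exact: fan_base.
apply: le_lt_trans Ne; apply: hilbert_dist_le => m.
have [c0 c1 c2 c3 c4] := coord_pt a01 zero01 zero01 zero01.
rewrite ler_pdivrMr ?exprn_gt0 //.
apply: (@le_trans _ _ (hgt N)); last first.
  by rewrite ler_peMr ?(ltW (hgt_gt0 N)) // exprn_ege1 // ler1n.
apply: (@le_trans _ _ (hgt n)); last exact: hgt_le.
have hn := ltW (hgt_gt0 n).
rewrite -!/(cube_coord _ _); case: m => [|[|[|[|m]]]].
- by rewrite c0 subrr normr0.
- by rewrite c1 e1 sub0r normrN ger0_norm.
- by rewrite c2 sub0r normrN ger0_norm // cube_coord_ge0.
- by rewrite c3 sub0r normrN ger0_norm // cube_coord_ge0.
- by rewrite c4 // (fan_tail fz) // subrr normr0.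
Qed.

Lemma fan_compactum_continuous x (U : set (hyperspace Q)) :
  open U -> U (fan_compactum x) ->
  exists N, forall y, (forall n, (n < N)%N -> x n = y n) -> U (fan_compactum y).
Proof.
move=> oU Ux; have /nbhs_ballP[e /= e0 eU] : nbhs (fan_compactum x) U.
  exact: open_nbhs_nbhs.
have e2 : 0 < e / 2 by rewrite divr_gt0.
have [N Ne] := hgt_small e2; exists N => y xy; apply: eU; rewrite ballEmdist /=.
apply: (@le_lt_trans _ _ (e / 2));
  last by rewrite ltr_pdivrMr // ltr_pMr // ltr1n.
apply: hausdorff_dist_le => //; first exact: fan_thickening Ne.
by apply: fan_thickening Ne => n /xy.
Qed.

End Fan.

(** * Rim-finiteness of the fans *)

Section Boundary.
Variables (R : realType) (X : topologicalType).

Lemma finite_subsingleton (T : Type) (A : set T) :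
  (forall a b, A a -> A b -> a = b) -> finite_set A.
Proof.
move=> H; case: (pselect (A !=set0)) => [[a Aa]|A0].
  by apply: (@sub_finite_set _ _ [set a]) => // b Ab /=; exact: H.
by rewrite (_ : A = set0) //; apply/eqP; apply: contrapT => /negP/set0P.
Qed.

(** A boundary point lies in [P], which is clopen, and has [g] at distance exactly [e] from [t0].
    There [g] is not locally constant, so the point is in [S], where each of the values [t0 + e] and
    [t0 - e] is taken at most once. *)
Lemma slab_rim_finite (P S : set X) (g : X -> R) (t0 e : R) :
  clopen P -> continuous g ->
  (forall z, P z -> ~ S z -> nbhs z [set w | g w = g z]) ->
  (forall z w, P z -> S z -> P w -> S w -> g z = g w -> z = w) ->
  open (P `&` [set w | `|g w - t0| < e]) /\
  finite_set (boundary (P `&` [set w | `|g w - t0| < e])).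
Proof.
move=> [oP cP] cg gloc ginj.
have cn : continuous (fun w => `|g w - t0|).
  by move=> w; apply: cvg_norm; apply: cvgB; [exact: cg|exact: cvg_cst].
have oU : open [set w | `|g w - t0| < e].
  exact: (proj1 (continuousP _) cn _ (@open_lt R e)).
have cE : closed [set w | `|g w - t0| <= e].
  exact: (proj1 (continuous_closedP _) cn _ (@closed_le R e)).
set U := _ `&` _.
have oPU : open U by exact: openI.
split=> //; apply: (@sub_finite_set _ _ ((P `&` S `&` [set w | g w = t0 + e])
  `|`
    (P `&` S `&` [set w | g w = t0 - e]))); last first.
  rewrite finite_setU; split; apply: finite_subsingleton => a b
    [[Pa Sa] ga] [[Pb Sb] gb]; apply: ginj => //; by rewrite ga gb.
move=> z [clz nint].
have nU : ~ U z.
  by move=> Uz; apply: nint; rewrite /interior; exact: open_nbhs_nbhs.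
have Pz : P z by apply: cP; move=> B /clz[w [[Pw _] Bw]]; exists w.
have ge : `|g z - t0| <= e.
  by apply: cE; move=> B /clz[w [[_ /= /ltW wU] Bw]]; exists w.
have eq : `|g z - t0| = e.
  by apply/eqP; rewrite eq_le ge leNgt; apply/negP => h; apply: nU.
have Sz : S z.
  apply: contrapT => nS; have /clz[w [[_ /= wU] gw]] := gloc z Pz nS.
  by move: wU; rewrite gw eq ltxx.
by move: eq; case: (ger0P (g z - t0)) => h eq; [left|right]; split => //=; lra.
Qed.

End Boundary.

Section FanTopology.
Variable R : realType.
Local Notation Q := (hilbert_cube R).
Local Notation cc n z := (cube_coord n (set_val z)).
Implicit Types (x y : nat -> nat).

Lemma nbhs_fan x (z : set_type (@fan R x)) U : nbhs z U <->
  exists2 e, 0 < e &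
    forall w : set_type (fan x), near4 e (set_val z) (set_val w) -> U w.
Proof. by apply: nbhs_sub_near4 => w n fw; exact: fan_tail fw. Qed.

Lemma fan_val x (z : set_type (@fan R x)) : fan x (set_val z).
Proof. exact: set_valP. Qed.

Lemma continuous_fan_coord x n : continuous (fun z :
  set_type (@fan R x) => cc n z).
Proof.
move=> z; apply: (@continuous_comp _ _ _ (set_val : set_type (fan x) -> Q)
  (@cube_coord R n)); [exact: initial_continuous|exact:
    (@continuous_coord R n)].
Qed.

Lemma fan_ext x (z w : set_type (@fan R x)) :
  cc 0 z = cc 0 w -> cc 1 z = cc 1 w ->
  cc 2 z = cc 2 w -> cc 3 z = cc 3 w -> z = w.
Proof.
by move=> *; apply: val_inj; apply: (fan_coord_inj (fan_val z) (fan_val w)).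
Qed.

Lemma near4_refl e (z : Q) : 0 < e -> near4 e z z.
Proof. by move=> e0 n _; rewrite subrr normr0. Qed.

Lemma open_fan_coord_lt x n (t : R) : open [set z :
  set_type (@fan R x) | cc n z < t].
Proof. exact: (proj1 (continuousP _) (@continuous_fan_coord x n) _ (@open_lt R
  t)). Qed.

Lemma closed_fan_coord_eq x n (t : R) : closed [set z :
  set_type (@fan R x) | cc n z = t].
Proof. exact: (proj1 (continuous_closedP _) (@continuous_fan_coord x n) _
  (@closed_eq R t)). Qed.

Lemma closed_fan_coord_le x n (t : R) : closed [set z :
  set_type (@fan R x) | cc n z <= t].
Proof. exact: (proj1 (continuous_closedP _) (@continuous_fan_coord x n) _
  (@closed_le R t)). Qed.

Lemma nbhs_fan_dyadic x k m (z : set_type (@fan R x)) :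
  (forall w : set_type (@fan R x), dyadic (cc k w)) -> cc k z = hgt R m ->
  nbhs z [set w : set_type (@fan R x) | cc k w = hgt R m].
Proof.
move=> dk zm; have : nbhs z [set w :
  set_type (@fan R x) | `|cc k z - cc k w| < hgt R m.+1].
  have /cvgrPdist_lt := @continuous_fan_coord x k z; apply; exact: hgt_gt0.
apply: filterS => w /=; rewrite zm distrC => h.
by apply: dyadic_near h; [exact: cube_coord_le1|exact: dk].
Qed.

End FanTopology.

Definition isolated_pt (X : topologicalType) (z : X) := nbhs z [set z].

Section RimFinite.
Variable R : realType.
Local Notation Q := (hilbert_cube R).
Local Notation cc n z := (cube_coord n (set_val z)).
Local Notation hgt := (hgt R).
Implicit Types (x y : nat -> nat).

Lemma fan_dyadic1 x (z : set_type (@fan R x)) : dyadic (cc 1 z).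
Proof. by case: (fan_val z). Qed.

Lemma fan_dyadic3 x (z : set_type (@fan R x)) : dyadic (cc 3 z).
Proof. by case: (fan_val z). Qed.

Lemma clopen_fan_below x k N : (forall z :
  set_type (@fan R x), dyadic (cc k z)) ->
  clopen [set z : set_type (@fan R x) | cc k z < hgt N].
Proof.
move=> dk; split; first exact: open_fan_coord_lt.
rewrite (_ : mkset _ = [set z : set_type (@fan R x) | cc k z <= hgt N.+1]).
  exact: closed_fan_coord_le.
apply/seteqP; split => z /= h; first by case: (dk z N) => // h'; lra.
by apply: le_lt_trans h _; exact: hgt_lt.
Qed.

Lemma clopen_fan_level x n : clopen [set z :
  set_type (@fan R x) | cc 1 z = hgt n].
Proof.
split; last exact: closed_fan_coord_eq.
by rewrite openE => z /= zn; apply: nbhs_fan_dyadic => // w; exact: fan_dyadic1.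
Qed.

(** Coordinates 1 and 3 are powers of 1/2, and so is coordinate 2, being a mark height. Each is
    therefore locally constant here, and coordinate 0 is determined by coordinate 1. *)
Lemma fan_isolated x (z : set_type (@fan R x)) : 0 < cc 3 z -> isolated_pt z.
Proof.
move=> z3; case: (fan_cases (fan_val z)) => [[_ [_ e]]|[n [e1 e0 _ _]]].
  by rewrite e ltxx in z3.
have [|m e3] := @dyadicP _ (cc 3 z) _ (fan_dyadic3 z).
  by rewrite z3 cube_coord_le1.
have hm := hgt_gt0 R m.
case=> [e|[i _ e2]]; first by rewrite e ltxx in z3.
have n1 := nbhs_fan_dyadic (@fan_dyadic1 x) e1.
have n3 := nbhs_fan_dyadic (@fan_dyadic3 x) e3.
have n2 : nbhs z [set w : set_type (fan x) | `|cc 2 z - cc 2 w| < hgt (n +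
  i).+1].
  have /cvgrPdist_lt := @continuous_fan_coord R x 2 z; apply; exact: hgt_gt0.
apply: filterS (filterI n1 (filterI n2 n3)) => w [/= w1 [w2 w3]].
have [w0 _ _ h] := fan_piece_cases (fan_val w) w1.
case: h => [h|[j _ wj]]; first by rewrite h in w3; rewrite -w3 ltxx in hm.
apply: fan_ext; rewrite ?w0 ?e0 ?w1 ?e1 ?w3 ?e3 //.
rewrite e2; apply: dyadic_near; first exact: cube_coord_le1.
  by rewrite wj; exact: dyadic_hgt.
by rewrite -e2 distrC.
Qed.

Lemma fan_rim_finite x : rim_finite (set_type (@fan R x)).
Proof.
exists [set U | open U /\ finite_set (boundary U)]; last by move=> U [].
split=> [U []//|z V /nbhs_fan[e e0 eV]].
suff : exists U : set (set_type (fan x)),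
    [/\ open U, finite_set (boundary U), U z & U `<=` V].
  by move=> [U [oU fU Uz UV]]; exists U.
have [N Ne] := hgt_small e0.
case: (fan_cases (fan_val z)) => [[z1 [z2 z3]]|[n [z1 z0 z2 z3 _]]].
  (* Around a point of the base arc the slab is cut by coordinate 0, which is constant on every
     small piece. *)
  have [||||oU fU] := @slab_rim_finite R (set_type (fan x))
    [set w | cc 1 w < hgt N] [set w | cc 1 w = 0] (fun w => cc 0 w) (cc 0 z) e.
  - by apply: clopen_fan_below; exact: fan_dyadic1.
  - exact: continuous_fan_coord.
  - move=> w _ w1; case: (fan_cases (fan_val w)) => [[]//|[m [e1 e0' _ _ _]]].
    apply: filterS (nbhs_fan_dyadic (@fan_dyadic1 x) e1) => v /= v1.
    by have [-> _ _ _] := fan_piece_cases (fan_val v) v1.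
  - move=> v w _ /= v1 _ /= w1 vw.
    case: (fan_cases (fan_val v)) => [[_ [v2 v3]]|[m [e1 _ _ _ _]]]; last first.
      by have := hgt_gt0 R m; rewrite -e1 v1 ltxx.
    case: (fan_cases (fan_val w)) => [[_ [w2 w3]]|[m [e1 _ _ _ _]]]; last first.
      by have := hgt_gt0 R m; rewrite -e1 w1 ltxx.
    by apply: fan_ext; rewrite ?v1 ?v2 ?v3 ?w1 ?w2 ?w3.
  - eexists; split; [exact: oU|exact: fU| |].
      by split => /=; rewrite ?z1 ?hgt_gt0 // subrr normr0.
    move=> w [/= w1 w0]; apply: eV.
    have [_ [w2 w3] _ _ _] := fan_val w.
    have h0 k : 0 <= cc k w by exact: cube_coord_ge0.
    have := h0 1%N; have := h0 2%N; have := h0 3%N => ? ? ?.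
    move=> [|[|[|[|//]]]] _; first by rewrite distrC.
    + by rewrite z1 sub0r normrN ger0_norm //; lra.
    + by rewrite z2 sub0r normrN ger0_norm //; lra.
    + by rewrite z3 sub0r normrN ger0_norm //; lra.
have [d0|dp] : cc 3 z = 0 \/ 0 < cc 3 z.
  by have := cube_coord_ge0 3 (set_val z); rewrite le_eqVlt => /predU1P[|];
    [left|right].
  (* Around a point of the [n]-th small arc the slab is cut by coordinate 2; the points of the piece
     off the arc are isolated. *)
  have [||||oU fU] := @slab_rim_finite R (set_type (fan x))
    ([set w | cc 1 w = hgt n] `&` [set w | cc 3 w < hgt N])
    [set w | cc 3 w = 0] (fun w => cc 2 w) (cc 2 z) e.
  - apply: clopenI; first exact: clopen_fan_level.
    by apply: clopen_fan_below; exact: fan_dyadic3.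
  - exact: continuous_fan_coord.
  - move=> w _ /= w3; have /fan_isolated : 0 < cc 3 w.
      by rewrite lt_neqAle cube_coord_ge0 andbT eq_sym; apply/eqP.
    by apply: filterS => _ ->.
  - move=> v w [/= v1 _] v3 [/= w1 _] w3 vw.
    have [v0 _ _ _] := fan_piece_cases (fan_val v) v1.
    have [w0 _ _ _] := fan_piece_cases (fan_val w) w1.
    by apply: fan_ext; rewrite ?v0 ?w0 ?v1 ?v3 ?w1 ?w3.
  - eexists; split; [exact: oU|exact: fU| |].
      by split; [split => //=; rewrite d0 hgt_gt0|rewrite /= subrr normr0].
    move=> w [[/= w1 w3] w2]; apply: eV.
    have [w0 _ _ _] := fan_piece_cases (fan_val w) w1.
    have h3 : 0 <= cc 3 w by exact: cube_coord_ge0.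
    move=> [|[|[|[|//]]]] _.
    + by rewrite z0 w0 subrr normr0.
    + by rewrite z1 w1 subrr normr0.
    + by rewrite distrC.
    + by rewrite d0 sub0r normrN ger0_norm //; lra.
(* The singleton of an isolated point is clopen, so its boundary is empty. *)
have zi := fan_isolated dp.
have zc v : closure [set z] v -> v = z.
  move=> clv; apply: contrapT => vz.
  have h k : cc k v = cc k z.
    have : closed [set w : set_type (fan x) | cc k w = cc k z].
      exact: closed_fan_coord_eq.
    by apply=> B /clv[w [-> Bw]]; exists z.
  by apply: vz; apply: fan_ext.
exists [set z]; split => //.
- by rewrite openE => _ ->.
- rewrite (_ : boundary _ = set0) //; apply/seteqP; split => // v [/zc -> nz].
  exact: nz zi.
- by move=> _ ->; apply: eV; exact: near4_refl.
Qed.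

End RimFinite.

(** * Homeomorphisms between fans *)

Section Homeo.
Variable R : realType.
Local Notation Q := (hilbert_cube R).
Local Notation cc n z := (cube_coord n (set_val z)).
Local Notation hgt := (hgt R).
Implicit Types (x y : nat -> nat).

(** The sliding map: the base arc is fixed and the [n]-th piece moves from [pos R x n] to
    [pos R y n]. It is given as a relation, from which choice yields the two inverse maps. *)
Definition transport x y (z : set_type (@fan R x)) (w : set_type (@fan R y)) :=
  [/\ cc 1 w = cc 1 z, cc 2 w = cc 2 z, cc 3 w = cc 3 z,
      cc 1 z = 0 -> cc 0 w = cc 0 z &
      forall n, cc 1 z = hgt n -> cc 0 w = pos R y n].

Lemma transport_ex x y (z : set_type (@fan R x)) :
  exists w : set_type (@fan R y), transport z w.
Proof.
have le1 n t : 0 <= t <= hgt n -> 0 <= t <= 1.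
  by move=> /andP[-> h] /=; exact: le_trans h (hgt_le1 R n).
case: (fan_cases (fan_val z)) => [[z1 [z2 z3]]|[n [z1 z0 z2 z3 h]]].
  have a01 : 0 <= cc 0 z <= 1 by rewrite cube_coord_ge0 cube_coord_le1.
  exists (SigSub (mem_set (fan_base y a01))).
  have [h0 h1 h2 h3 _] := coord_pt a01 (zero01 R) (zero01 R) (zero01 R).
  split; rewrite /= ?h0 ?h1 ?h2 ?h3 ?z1 ?z2 ?z3 //.
  by move=> n e; have := hgt_gt0 R n; rewrite -e ltxx.
have c01 : 0 <= cc 2 z <= hgt n by rewrite cube_coord_ge0.
have d01 : 0 <= cc 3 z <= hgt n by rewrite cube_coord_ge0.
exists (SigSub (mem_set (fan_piece y c01 d01 (fan_dyadic3 z) h))).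
have [h0 h1 h2 h3 _] := coord_pt (pos01 R y n) (hgt01 R n) (le1 _ _ c01) (le1 _
  _ d01).
split; rewrite /= ?h0 ?h1 ?h2 ?h3 ?z1 //.
  by move=> e; have := hgt_gt0 R n; rewrite e ltxx.
by move=> m /hgt_inj ->.
Qed.

Lemma transportK x y (z v : set_type (@fan R x)) (w : set_type (@fan R y)) :
  transport z w -> transport w v -> v = z.
Proof.
move=> [w1 w2 w3 wb wp] [v1 v2 v3 vb vp].
apply: fan_ext; rewrite ?v1 ?v2 ?v3 //.
case: (fan_cases (fan_val z)) => [[z1 _]|[n [z1 z0 _ _ _]]].
  by rewrite vb ?wb // w1.
by rewrite (vp n) ?z0 // w1.
Qed.

(** Each piece is open and is moved by a translation. Continuity at the base arc holds because the
    [n]-th piece moves by at most [hgt n], which tends to 0. *)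
Lemma transport_continuous x y (f :
  set_type (@fan R x) -> set_type (@fan R y)) :
  (forall n, (x n <= y n + 1)%N && (y n <= x n + 1)%N) ->
  (forall z, transport z (f z)) -> continuous f.
Proof.
move=> xy tf z U /nbhs_fan[e e0 eU].
have e2 : 0 < e / 2 by rewrite divr_gt0.
have [z1 z2 z3 zb zp] := tf z.
suff : exists2 d, 0 < d & forall w :
  set_type (fan x), near4 d (set_val z) (set_val w) ->
    d <= e /\ `|cc 0 (f z) - cc 0 (f w)| < e.
  move=> [d d0 H]; apply/nbhs_fan; exists d => // w zw; apply: eU.
  have [de he] := H w zw; have [w1 w2 w3 _ _] := tf w.
  move=> [|[|[|[|//]]]] _ //; rewrite ?z1 ?w1 ?z2 ?w2 ?z3 ?w3.
  - exact: lt_le_trans (zw 1%N isT) de.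
  - exact: lt_le_trans (zw 2%N isT) de.
  - exact: lt_le_trans (zw 3%N isT) de.
case: (fan_cases (fan_val z)) => [[b0 _]|[n [bn an _ _ _]]]; last first.
  exists (Num.min e (hgt n.+1)); first by rewrite lt_min e0 hgt_gt0.
  move=> w zw; split; first by rewrite ge_min lexx.
  have wn : cc 1 w = hgt n.
    apply: fan_level (fan_val w) _; rewrite -bn distrC.
    by apply: lt_le_trans (zw 1%N isT) _; rewrite ge_min lexx orbT.
  have [_ _ _ _ wp] := tf w.
  by rewrite (zp n) // (wp n) // subrr normr0.
exists (e / 2) => // w zw; split; first by lra.
have [_ _ _ wb wp] := tf w; rewrite zb //.
have za := zw 0%N isT.
case: (fan_cases (fan_val w)) => [[w1 _]|[n [w1 w0 _ _ _]]].
  by rewrite wb //; lra.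
rewrite (wp n) //.
(* Closeness of [w] to the base arc bounds its level, and this level bounds the displacement of its
   piece. *)
have hn : hgt n < e / 2.
  by have := zw 1%N isT; rewrite b0 w1 sub0r normrN gtr0_norm // hgt_gt0.
have /andP[xy1 xy2] := xy n.
have := pos_near R xy1 xy2; rewrite -w0 => pn.
have := ler_distD (cc 0 w) (cc 0 z) (pos R y n); lra.
Qed.

Lemma fan_homeomorphic x y :
  (forall n, (x n <= y n + 1)%N && (y n <= x n + 1)%N) ->
  homeomorphic (set_type (@fan R x)) (set_type (@fan R y)).
Proof.
move=> xy; have /boolp.choice[f fP] := @transport_ex x y.
have /boolp.choice[g gP] := @transport_ex y x.
exists f, g; split.
- by move=> z; exact: transportK (fP z) (gP _).
- by move=> w; exact: transportK (gP w) (fP _).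
- exact: transport_continuous fP.
- by apply: transport_continuous gP => n; rewrite andbC.
Qed.

End Homeo.

(** * A topological label for the small arcs *)

Section Rank.
Implicit Types X Y : topologicalType.

(** On a small arc of a fan these are exactly the [n] labelled points, by [fan_mark] and
    [fan_mark_height]. *)
Definition is_mark X (z : X) :=
  ~ isolated_pt z /\ forall U, nbhs z U -> exists2 w, U w & isolated_pt w.

(* The label of a small arc, phrased without connected components so that its
   topological invariance is immediate. *)
Definition rank_ge X (z : X) (l : nat) := forall C : set X, clopen C -> C z ->
  exists f : nat -> X, (forall i j, (i < l)%N -> (j < l)%N -> f i = f j ->
    i = j) /\
    forall i, (i < l)%N -> C (f i) /\ is_mark (f i).

Lemma isolated_homeo X Y (f : X -> Y) (g : Y -> X) z :
  cancel f g -> cancel g f -> continuous g ->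
  isolated_pt z -> isolated_pt (f z).
Proof.
move=> fK gK cg iz; have : nbhs (f z) (g @^-1` [set z]) by apply: cg;
  rewrite fK.
by apply: filterS => w /= <-; rewrite gK.
Qed.

Lemma is_mark_homeo X Y (f : X -> Y) (g : Y -> X) z :
  cancel f g -> cancel g f -> continuous f -> continuous g ->
  is_mark z -> is_mark (f z).
Proof.
move=> fK gK cf cg [nz zU]; split.
  by move=> /(isolated_homeo gK fK cf); rewrite fK.
move=> U fU; have [w Uw iw] := zU _ (cf _ _ fU).
by exists (f w) => //; exact: isolated_homeo iw.
Qed.

Lemma rank_ge_homeo X Y (f : X -> Y) (g : Y -> X) z l :
  cancel f g -> cancel g f -> continuous f -> continuous g ->
  rank_ge z l -> rank_ge (f z) l.
Proof.
move=> fK gK cf cg rz C [oC cC] Cz.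
have cfC : clopen (f @^-1` C).
  by split; [exact: (proj1 (continuousP _) cf)|exact:
    (proj1 (continuous_closedP _) cf)].
have [h [hinj hC]] := rz _ cfC Cz; exists (f \o h); split.
  by move=> i j il jl /(can_inj fK); exact: hinj.
by move=> i /hC[? mi]; split => //; exact: is_mark_homeo mi.
Qed.

Lemma clopen_path (R : realType) X (p : R -> X) (C : set X) s t :
  continuous p -> clopen C -> C (p s) -> C (p t).
Proof.
move=> cp [oC cC] Cs.
have cT : connected [set: R] by apply/connected_intervalP.
have : p @^-1` C = setT.
  apply: cT; first by exists s.
  - by exists (p @^-1` C); rewrite ?setTI //; exact: (proj1 (continuousP _) cp).
  - by exists (p @^-1` C); rewrite ?setTI //;
      exact: (proj1 (continuous_closedP _) cp).
by move=> e; have : [set: R] t by []; rewrite -e.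
Qed.

End Rank.

Section FanRank.
Variable R : realType.
Local Notation Q := (hilbert_cube R).
Local Notation cc n z := (cube_coord n (set_val z)).
Local Notation hgt := (hgt R).
Implicit Types (x y : nat -> nat).

Lemma fan_base_ex x a : 0 <= a <= 1 -> exists w : set_type (@fan R x),
  [/\ cc 0 w = a, cc 1 w = 0, cc 2 w = 0 & cc 3 w = 0].
Proof.
move=> a01; exists (SigSub (mem_set (fan_base x a01))).
by have [h0 h1 h2 h3 _] := coord_pt a01 (zero01 R) (zero01 R) (zero01 R).
Qed.

Lemma fan_piece_ex x n c d : 0 <= c <= hgt n -> 0 <= d <= hgt n -> dyadic d ->
  d = 0 \/ mark_heights n c -> exists w : set_type (@fan R x),
  [/\ cc 0 w = pos R x n, cc 1 w = hgt n, cc 2 w = c & cc 3 w = d].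
Proof.
move=> c01 d01 dd h; exists (SigSub (mem_set (fan_piece x c01 d01 dd h))).
have le1 t : 0 <= t <= hgt n -> 0 <= t <= 1.
  by move=> /andP[-> h'] /=; exact: le_trans h' (hgt_le1 R n).
by have [h0 h1 h2 h3 _] := coord_pt (pos01 R x n) (hgt01 R n) (le1 _ c01) (le1
  _ d01).
Qed.

Lemma fan_seg_ex x n c : 0 <= c <= hgt n -> exists w : set_type (@fan R x),
  [/\ cc 0 w = pos R x n, cc 1 w = hgt n, cc 2 w = c & cc 3 w = 0].
Proof.
move=> c01; apply: fan_piece_ex => //; [|exact: dyadic0|by left].
by rewrite lexx ltW // hgt_gt0.
Qed.

(** For nonnegative [h], the retraction of the line onto [[0,h]]; it extends parametrizations of
    arcs to all of [R], as [clopen_path] requires. *)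
Definition clamp (h t : R) := Num.max 0 (Num.min h t).

Lemma clamp_in h t : 0 <= h -> 0 <= clamp h t <= h.
Proof. by move=> h0; rewrite /clamp le_max lexx /= ge_max h0 ge_min lexx. Qed.

Lemma clamp_id h t : 0 <= t <= h -> clamp h t = t.
Proof. by move=> /andP[t0 th]; rewrite /clamp (min_idPr th) (max_idPr t0). Qed.

Lemma clamp_dist h s t : 0 <= h -> `|clamp h s - clamp h t| <= `|s - t|.
Proof.
move=> h0; rewrite /clamp ler_norml.
case: (leP h s) => hs; case: (leP h t) => ht; case: (ger0P (s - t)) => ?;
  case: (leP 0 h) => ?; case: (leP 0 s) => ?; case: (leP 0 t) => ?;
    apply/andP; split; lra.
Qed.

Lemma fan_not_isolated x (z : set_type (@fan R x)) :
  cc 3 z = 0 -> ~ isolated_pt z.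
Proof.
(* Any point of [[0,h]] has another one within [e]: move up from the lower half and down from the
   upper half, by at most [h / 2]. *)
have flip (h t e : R) : 0 < h -> 0 < e -> 0 <= t <= h ->
    exists2 t', 0 <= t' <= h & t' != t /\ `|t - t'| < e.
  move=> h0 e0 /andP[t0 th].
  have [m [m0 me mh]] : exists m : R, [/\ 0 < m, m < e & m <= h / 2].
    exists (Num.min (e / 2) (h / 2)); split.
    - by rewrite lt_min !divr_gt0.
    - by rewrite gt_min; apply/orP; left;
        rewrite ltr_pdivrMr // ltr_pMr // ltr1n.
    - by rewrite ge_min lexx orbT.
  have [tm|tm] := lerP t (h / 2).
    exists (t + m); first by apply/andP; split; lra.
    split; first by rewrite -subr_eq0 addrC addKr gt_eqF.
    by rewrite opprD addNKr normrN gtr0_norm.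
  exists (t - m); first by apply/andP; split; lra.
  split; first by rewrite -subr_eq0 addrC addKr oppr_eq0 gt_eqF.
  by rewrite opprB addrC subrK gtr0_norm.
move=> z3 /nbhs_fan[e e0 eU].
case: (fan_cases (fan_val z)) => [[z1 [z2 _]]|[n [z1 z0 z2 _ _]]].
  have [|t' t01 [t'z t'e]] := flip 1 (cc 0 z) e ltr01 e0.
    by rewrite cube_coord_ge0 cube_coord_le1.
  have [w [w0 w1 w2 w3]] := @fan_base_ex x _ t01.
  have : w = z.
    apply: eU => -[|[|[|[|//]]]] _; rewrite ?w0 // ?w1 ?w2 ?w3 ?z1 ?z2 ?z3;
      by rewrite subrr normr0.
  by move=> wz; move: t'z; rewrite -wz w0 eqxx.
have [|t' t01 [t'z t'e]] := flip (hgt n) (cc 2 z) e (hgt_gt0 R n) e0.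
  by rewrite cube_coord_ge0.
have [w [w0 w1 w2 w3]] := @fan_seg_ex x _ _ t01.
have : w = z.
  by apply: eU => -[|[|[|[|//]]]] _; rewrite ?w0 ?w1 ?w2 // ?w3 ?z1 ?z0 ?z3;
    rewrite subrr normr0.
by move=> wz; move: t'z; rewrite -wz w2 eqxx.
Qed.

Lemma fan_mark x n i (z : set_type (@fan R x)) : (i < n)%N ->
  cc 1 z = hgt n -> cc 2 z = hgt (n + i) -> cc 3 z = 0 -> is_mark z.
Proof.
move=> im z1 z2 z3; split; first exact: fan_not_isolated.
move=> U /nbhs_fan[e e0 eU]; have [m me] := hgt_small e0.
have [z0 _ _ _] := fan_piece_cases (fan_val z) z1.
have [w [w0 w1 w2 w3]] : exists w : set_type (@fan R x), [/\ cc 0 w = pos R x n,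
    cc 1 w = hgt n, cc 2 w = hgt (n + i) & cc 3 w = hgt (n + m)].
  apply: fan_piece_ex.
  - by rewrite (ltW (hgt_gt0 R _)) hgt_le // leq_addr.
  - by rewrite (ltW (hgt_gt0 R _)) hgt_le // leq_addr.
  - exact: dyadic_hgt.
  - by right; exists i.
exists w; last by apply: fan_isolated; rewrite w3 hgt_gt0.
apply: eU => -[|[|[|[|//]]]] _; rewrite ?w0 ?z0 ?w1 ?z1 ?w2 ?z2 ?w3 ?z3;
  rewrite ?subrr ?normr0 //.
rewrite sub0r normrN gtr0_norm ?hgt_gt0 //.
by apply: le_lt_trans me; apply: hgt_le; rewrite leq_addl.
Qed.

(** Isolated points have positive coordinate 3, hence a mark height as coordinate 2. A limit of such
    points at level [n] inherits the height because [mark_heights n] is closed. *)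
Lemma fan_mark_height x n (z : set_type (@fan R x)) : is_mark z ->
  cc 1 z = hgt n -> cc 3 z = 0 /\ mark_heights n (cc 2 z).
Proof.
move=> [nz mz] z1; split.
  apply: contrapT => z3; apply: nz; apply: fan_isolated.
  by rewrite lt_neqAle cube_coord_ge0 andbT eq_sym; apply/eqP.
apply: (@closed_mark_heights R n) => B cB.
have n1 := nbhs_fan_dyadic (@fan_dyadic1 R x) z1.
have n2 : nbhs z [set w : set_type (fan x) | B (cc 2 w)].
  exact: (@continuous_fan_coord R x 2 z).
have [w [/= w1 w2] iw] := mz _ (filterI n1 n2).
have [_ _ _ [w3|w3]] := fan_piece_cases (fan_val w) w1.
  by case: (fan_not_isolated w3).
by exists (cc 2 w).
Qed.

Lemma fan_clopen_seg x n (C : set (set_type (@fan R x))) (z w :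
  set_type (@fan R x)) :
  clopen C -> C z -> cc 1 z = hgt n -> cc 3 z = 0 ->
  cc 1 w = hgt n -> cc 3 w = 0 -> C w.
Proof.
move=> cC Cz z1 z3 w1 w3.
have h0 := ltW (hgt_gt0 R n).
have /boolp.choice[p pP] t := @fan_seg_ex x n _ (clamp_in t h0).
have pcc v : cc 1 v = hgt n -> cc 3 v = 0 -> p (cc 2 v) = v.
  move=> v1 v3; have [v0 v2 _ _] := fan_piece_cases (fan_val v) v1.
  have [p0 p1 p2 p3] := pP (cc 2 v).
  by apply: fan_ext; rewrite ?p0 ?p1 ?p2 ?p3 ?v0 ?v1 ?v3 // clamp_id //
    cube_coord_ge0.
rewrite -(pcc w w1 w3).
apply: (@clopen_path R _ p C (cc 2 z) (cc 2 w) _ cC); last by rewrite (pcc z).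
move=> t U /nbhs_fan[e e0 eU].
have : nbhs t (ball t e) by exact: nbhsx_ballx.
apply: filterS => s ts; apply: eU.
have [p0 p1 p2 p3] := pP t; have [q0 q1 q2 q3] := pP s.
move=> [|[|[|[|//]]]] _; rewrite ?p0 ?q0 ?p1 ?q1 ?p2 ?q2 ?p3 ?q3 ?subrr ?normr0
  //.
exact: le_lt_trans (clamp_dist _ _ h0) ts.
Qed.

Lemma fan_clopen_base x (C : set (set_type (@fan R x))) (z w :
  set_type (@fan R x)) :
  clopen C -> C z -> cc 1 z = 0 -> cc 1 w = 0 -> C w.
Proof.
move=> cC Cz z1 w1.
have /boolp.choice[p pP] t := @fan_base_ex x _ (clamp_in t ler01).
have pcc v : cc 1 v = 0 -> p (cc 0 v) = v.
  move=> v1; have [p0 p1 p2 p3] := pP (cc 0 v).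
  case: (fan_cases (fan_val v)) => [[_ [v2 v3]]|[n [e _ _ _ _]]].
    by apply: fan_ext; rewrite ?p0 ?p1 ?p2 ?p3 ?v1 ?v2 ?v3 // clamp_id //
      cube_coord_ge0 cube_coord_le1.
  by have := hgt_gt0 R n; rewrite -e v1 ltxx.
rewrite -(pcc w w1).
apply: (@clopen_path R _ p C (cc 0 z) (cc 0 w) _ cC); last by rewrite (pcc z).
move=> t U /nbhs_fan[e e0 eU].
have : nbhs t (ball t e) by exact: nbhsx_ballx.
apply: filterS => s ts; apply: eU.
have [p0 p1 p2 p3] := pP t; have [q0 q1 q2 q3] := pP s.
move=> [|[|[|[|//]]]] _; rewrite ?p0 ?q0 ?p1 ?q1 ?p2 ?q2 ?p3 ?q3 ?subrr ?normr0
  //.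
exact: le_lt_trans (clamp_dist _ _ ler01) ts.
Qed.

Lemma fan_marks_in x n (C : set (set_type (@fan R x))) (z :
  set_type (@fan R x)) :
  clopen C -> C z -> cc 1 z = hgt n -> cc 3 z = 0 ->
  exists f : nat -> set_type (@fan R x),
    (forall i j, (i < n)%N -> (j < n)%N -> f i = f j -> i = j) /\
    forall i, (i < n)%N -> C (f i) /\ is_mark (f i).
Proof.
move=> cC Cz z1 z3.
have c01 i : 0 <= hgt (n + i) <= hgt n.
  by rewrite (ltW (hgt_gt0 R _)) hgt_le // leq_addr.
have /boolp.choice[f fP] i := @fan_seg_ex x n _ (c01 i).
exists f; split.
  move=> i j _ _ e; have [_ _ i2 _] := fP i; have [_ _ j2 _] := fP j.
  by move: i2; rewrite e j2 => /hgt_inj/addnI.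
move=> i im; have [_ f1 f2 f3] := fP i; split;
  last exact: (fan_mark im f1 f2 f3).
exact: (fan_clopen_seg cC Cz z1 z3 f1 f3).
Qed.

(** A clopen set meeting the arc contains the whole arc with its [n] marks. Conversely the level [n]
    is a clopen set, and its marks are determined by one of [n] heights. *)
Lemma fan_rank_piece x n l (z : set_type (@fan R x)) :
  cc 1 z = hgt n -> cc 3 z = 0 -> rank_ge z l <-> (l <= n)%N.
Proof.
move=> z1 z3; split=> [rz|ln C cC Cz]; last first.
  have [f [finj fC]] := fan_marks_in cC Cz z1 z3; exists f; split.
    by move=> i j il jl; apply: finj; exact: leq_trans ln.
  by move=> i il; apply: fC; exact: leq_trans ln.
have [f [finj fC]] := rz _ (clopen_fan_level R x n) z1.
have /boolp.choice[k kP] : forall i : 'I_l, exists k :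
  'I_n, cc 2 (f i) = hgt (n + k).
  move=> i; have [/= f1 mf] := fC i (ltn_ord i).
  have [_ [j jn e]] := fan_mark_height mf f1.
  by exists (Ordinal jn).
have kinj : injective k.
  move=> i j kij; apply: ord_inj; apply: finj; [exact: ltn_ord|exact: ltn_ord|].
  have [/= i1 /fan_mark_height/(_ i1)[i3 _]] := fC i (ltn_ord i).
  have [/= j1 /fan_mark_height/(_ j1)[j3 _]] := fC j (ltn_ord j).
  have [i0 _ _ _] := fan_piece_cases (fan_val (f i)) i1.
  have [j0 _ _ _] := fan_piece_cases (fan_val (f j)) j1.
  by apply: fan_ext; rewrite ?i0 ?j0 ?i1 ?j1 ?i3 ?j3 // !kP kij.
by have := leq_card k kinj; rewrite !card_ord.
Qed.

(** A clopen set containing a base point contains the whole base arc, hence small arcs of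
    arbitrarily large index near its end 0, and these carry as many marks as desired. *)
Lemma fan_rank_base x l (z : set_type (@fan R x)) :
  (forall N, exists2 n, (N <= n)%N & x n = 0%N) -> cc 1 z = 0 -> rank_ge z l.
Proof.
move=> x0 z1 C cC Cz.
have [q [q0 q1 q2 q3]] := @fan_base_ex x 0 (zero01 R).
have Co : C q by exact: (fan_clopen_base cC Cz z1 q1).
have /nbhs_fan[e e0 eC] : nbhs q C by case: cC => oC _; exact: open_nbhs_nbhs.
have [N Ne] := hgt_small e0; have [n nN xn] := x0 (maxn N l).
have [w [w0 w1 w2 w3]] : exists w : set_type (@fan R x),
    [/\ cc 0 w = pos R x n, cc 1 w = hgt n, cc 2 w = 0 & cc 3 w = 0].
  by apply: fan_seg_ex; rewrite lexx ltW // hgt_gt0.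
have Cw : C w.
  apply: eC => -[|[|[|[|//]]]] _;
    rewrite ?q0 ?q1 ?q2 ?q3 ?w0 ?w1 ?w2 ?w3 ?pos0 ?subrr ?normr0 //.
  rewrite sub0r normrN gtr0_norm ?hgt_gt0 //.
  by apply: le_lt_trans Ne; apply: hgt_le; apply: leq_trans nN;
    rewrite leq_maxl.
have ln : (l <= n)%N by apply: leq_trans nN; rewrite leq_maxr.
by apply: (proj2 (fan_rank_piece l w1 w3)).
Qed.

(** A homeomorphism preserves ranks, so it sends the [n]-th small arc of [fan x] to the [n]-th one
    of [fan y]. The arcs with [x n = 0] converge to the end 0 of the base arc, while their images
    sit infinitely often at position 0 and infinitely often at position 1, against continuity. *)
Theorem fan_rigid x y :
  (forall N, exists n, [/\ (N <= n)%N, x n = 0%N & y n = 0%N]) ->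
  (forall N, exists n, [/\ (N <= n)%N, x n = 0%N & y n = (2 ^ n)%N]) ->
  ~ homeomorphic (set_type (@fan R x)) (set_type (@fan R y)).
Proof.
move=> xy00 xy01 [h [g [hK gK ch cg]]].
have y0 N : exists2 n, (N <= n)%N & y n = 0%N.
  by have [n [? _ ?]] := xy00 N; exists n.
(* The image is not isolated and has rank exactly [n]; base points of [fan y] have unbounded rank,
   so the image lies on the small arc of index [n]. *)
have level n (z : set_type (fan x)) : cc 1 z = hgt n -> cc 3 z = 0 ->
    cc 0 (h z) = pos R y n.
  move=> z1 z3.
  have h3 : cc 3 (h z) = 0.
    apply: contrapT => h3; apply: (fan_not_isolated z3); rewrite -[z]hK.
    apply: (isolated_homeo gK hK ch); apply: fan_isolated.
    by rewrite lt_neqAle cube_coord_ge0 andbT eq_sym; apply/eqP.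
  have rank l : rank_ge (h z) l <-> (l <= n)%N.
    rewrite -(fan_rank_piece l z1 z3); split=> [|]; last exact: rank_ge_homeo.
    by rewrite -[X in _ -> rank_ge X l]hK; exact: rank_ge_homeo.
  case: (fan_cases (fan_val (h z))) => [[h1 _]|[m [h1 h0 _ _ _]]].
    by have /rank := @fan_rank_base y n.+1 (h z) y0 h1; rewrite ltnn.
  rewrite h0; congr (pos R y _); apply/eqP; rewrite eqn_leq.
  apply/andP; split; first by apply/rank/(fan_rank_piece _ h1 h3).
  by apply/(fan_rank_piece _ h1 h3)/rank.
have [q [q0 q1 q2 q3]] := @fan_base_ex x 0 (zero01 R).
(* Positions 0 and 1 cannot both be at distance less than 1/2 from the same point. *)
have half : 0 < 2^-1 :> R by rewrite invr_gt0.
have /nbhs_fan[e e0 eh] : nbhs q [set z | `|cc 0 (h q) - cc 0 (h z)| < 2^-1].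
  have /cvgrPdist_lt := continuous_comp (ch q) (@continuous_fan_coord R y 0 (h
    q)).
  by apply.
have [N Ne] := hgt_small e0.
have near n : (N <= n)%N -> x n = 0%N -> `|cc 0 (h q) - pos R y n| < 2^-1.
  move=> Nn xn.
  have [w [w0 w1 w2 w3]] : exists w : set_type (@fan R x),
      [/\ cc 0 w = pos R x n, cc 1 w = hgt n, cc 2 w = 0 & cc 3 w = 0].
    by apply: fan_seg_ex; rewrite lexx ltW // hgt_gt0.
  rewrite -(level n w w1 w3); apply: eh => -[|[|[|[|//]]]] _;
    rewrite ?q0 ?q1 ?q2 ?q3 ?w0 ?w1 ?w2 ?w3 ?pos0 ?subrr ?normr0 //.
  rewrite sub0r normrN gtr0_norm ?hgt_gt0 //.
  by apply: le_lt_trans Ne; apply: hgt_le.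
have [n [nN xn yn]] := xy00 N; have [m [mN xm ym]] := xy01 N.
have := near n nN xn; have := near m mN xm; rewrite (pos0 R yn) (pos1 R ym).
by rewrite !ltr_norml => /andP[? ?] /andP[? ?]; lra.
Qed.

End FanRank.

(** * Non-classifiability *)

Local Close Scope ring_scope.

Lemma force_infinitely_often (T : countType) (S : pred T) s (v : nat -> T) :
  (forall n, S (v n)) ->
  force S s (fun z => forall N, exists2 n, (N <= n)%N & z n = v n).
Proof.
move=> Sv.
apply: (@force_fam _ _ _ _ _ (fun N u =>
    exists2 n, (N <= n)%N & (n < size u)%N /\ nth (v 0%N) u n = v n)) =>
      [N t St st|].
  (* Copying [v] on [N.+1] further places reaches the index [size t + N], which is at least [N]. *)
  pose u := t ++ map v (iota (size t) N.+1).
  have su : size u = (size t + N.+1)%N by rewrite size_cat size_map size_iota.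
  exists u; split.
  - by rewrite all_cat St all_map; apply/allP => i _ /=.
  - exact: prefix_prefix.
  - exists (size t + N)%N; first exact: leq_addl.
    rewrite su addnS ltnSn nth_cat addKn; split=> //.
    case: ifP => [|_]; first by rewrite ltnNge leq_addr.
    by rewrite (nth_map 0%N) ?size_iota // nth_iota.
move=> z _ _ H N; have [m [n Nn [nm e]]] := H N; exists n => //.
by rewrite -e nth_mkseq //; move: nm; rewrite size_mkseq.
Qed.

Section Reduction.
Variable R : realType.

Lemma borel_cylinder (s : seq nat) : borel (fun x :
  nat -> nat => mkseq x (size s) = s).
Proof.
apply: (@borel_ext _ (fun x => forall i : 'I_(size s), x i = nth 0%N s i)).
  move=> x; split=> [H|e i]; last first.
    by have := congr1 (nth 0%N ^~ i) e; rewrite nth_mkseq.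
  apply: (@eq_from_nth _ 0%N); rewrite ?size_mkseq // => i il.
  by rewrite nth_mkseq // (H (Ordinal il)).
by apply: borel_forall => i;
  exact: (@borel_coord nat i (fun a => a = nth 0%N s i)).
Qed.

Lemma borel_fan_compactum (B : set (hyperspace (hilbert_cube R))) :
  borel_sets B -> borel (fun x => B (fan_compactum R x)).
Proof.
move: B; apply: smallest_sub.
  split.
  - exact: borel_const.
  - move=> A bA; apply: (borel_ext _ (borel_compl bA)) => x.
    by split=> [h|[]//]; split.
  - move=> A bA; apply: (borel_ext _ (borel_bigcup bA)) => x.
    by split=> [[n An]|[n _ An]]; exists n.
(* By continuity the preimage of an open set is the union of the countably many cylinders that it
   contains. *)
move=> U oU; apply: (@borel_ext _ (fun x => exists s : seq nat,
    mkseq x (size s) = s /\ (forall y, mkseq y (size s) = s ->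
      U (fan_compactum R y)))).
  move=> x; split=> [[s [xs]]|Ux]; first exact.
  have [N xN] := fan_compactum_continuous oU Ux.
  exists (mkseq x N); rewrite size_mkseq; split => // y yx; apply: xN => n nN.
  by have := congr1 (nth 0%N ^~ n) yx; rewrite !nth_mkseq.
apply: borel_exists => s; apply: borel_and; first exact: borel_cylinder.
exact: borel_const.
Qed.

Definition coded_fan (x : nat -> nat) : set_type (coded_class R rim_finite) :=
  SigSub (mem_set (fan_rim_finite R x :
    coded_class R rim_finite (fan_compactum R x))).

Lemma open_proj (I : eqType) (K : I -> topologicalType) i (A : set (K i)) :
  open A -> open [set u : prod_topology K | A (u i)].
Proof.
move=> oA; rewrite openE => u Au.
exact: (@proj_continuous I K i u A (open_nbhs_nbhs (conj oA Au))).
Qed.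

Lemma open_atom (L : language) (s : symbol L) (t : (arity s).-tuple nat) :
  open [set M : nat_structure L | M s t].
Proof.
have o1 := @open_proj _ (fun _ : (arity s).-tuple nat => bool) t _
  (discrete_open [set b : bool | b]).
exact: (@open_proj _ (fun s :
  symbol L => {ptws (arity s).-tuple nat -> bool}) s _ o1).
Qed.

End Reduction.

Theorem theorem18 (R : realType) :
  ~ classifiable_by_countable_structures
      (coded_borel R rim_finite) (coded_homeomorphic R rim_finite).
Proof.
move=> [L [f [fB fE]]].
pose M x (s : symbol L) (t : (arity s).-tuple nat) := f (coded_fan R x) s t.
have bM (s : symbol L) (t : (arity s).-tuple nat) : borel (fun x => M x s t).
  (* The Borel structure on the class is a trace, so the preimage of an atomic condition is cut out
     by a Borel set [B] of the hyperspace. *)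
  have [B bB BE] : coded_borel R rim_finite (f @^-1` [set N | N s t]).
    by apply: fB; apply: sub_sigma_algebra; exact: open_atom.
  apply: (borel_ext _ (borel_fan_compactum bB)) => x.
  have := congr1 (fun A => A (coded_fan R x)) BE.
  by rewrite setTI => e; rewrite /M -[is_true _]/((f @^-1` [set N | N s t]) _)
    -e.
have close_iso x y : (forall n, close_pair 1 (x n, y n)) -> str_iso M x y.
  move=> xy; apply: (proj1 (fE (coded_fan R x) (coded_fan R y))).
  exact: fan_homeomorphic.
have fiso := generic_iso bM close_iso.
have f00 := @force_infinitely_often _ predT [::] (fun=> (0%N, 0%N)) (fun=> isT).
have f01 := @force_infinitely_often _ predT [::] (fun n =>
  (0%N, (2 ^ n)%N)) (fun=> isT).
(* One generic pair has isomorphic structures and yet takes both patterns infinitely often, so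
   [fan_rigid] contradicts the reduction. *)
have [z [_ _ [iz [z00 z01]]]] := force_sat (all_predT [::])
  (ex_intro _ (0%N, 0%N) isT) (force_and fiso (force_and f00 f01)).
apply: (@fan_rigid R (fst \o z) (snd \o z)).
- by move=> N; have [n Nn e] := z00 N; exists n; rewrite /= e.
- by move=> N; have [n Nn e] := z01 N; exists n; rewrite /= e.
- exact: (proj2 (fE (coded_fan R _) (coded_fan R _)) iz).
Qed.
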